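(* Let $\alpha<\omega_1$ and let $f:2^\omega\to\mathbb R$ be a Borel function with $f\notin\mathcal B_\alpha(2^\omega)$. Let $Z\in 2^\omega$ and $a\in\mathcal O^Z$ with $|a|^Z_{\mathcal O}=\alpha+1$, and write $j_{\alpha+1}=j^Z_a$. Then $j_{\alpha+1}\le_{\mathbf m} f$ or $-j_{\alpha+1}\le_{\mathbf m} f$.
   Context: Baire classes: $\mathcal B_0(2^\omega)$ is the set of continuous $f:2^\omega\to\mathbb R$; for $\alpha>0$, $\mathcal B_\alpha(2^\omega)$ is the set of pointwise limits of sequences of functions from $\bigcup_{\beta<\alpha}\mathcal B_\beta(2^\omega)$. Jump functions: for $Z\in2^\omega$, $a\in\mathcal O^Z$ (Kleene's $\mathcal O$ relative to $Z$) and $A\in 2^\omega$, let $(A\oplus Z)_{(a)}$ be the $n$-th Turing jump $(A\oplus Z)^{(n)}$ if $|a|^Z_{\mathcal O}=n<\omega$, and $H^{A\oplus Z}_{2^a}$ (the hyperarithmetic set at notation $2^a$) if $|a|^Z_{\mathcal O}\ge\omega$. Define $j^Z_a:2^\omega\to\mathbb R$ by $j^Z_a(A)=\sum_{i\in(A\oplus Z)_{(a)}}2^{-(i+1)}$. Questions: for $y\in\mathbb R$, $p\in\mathbb Q$, $\varepsilon\in\mathbb Q^+$, a bit $b\in\{0,1\}$ is a correct answer to ''$y\lesssim_\varepsilon p$'' if either $b=1$ and $y<p+\varepsilon$, or $b=0$ and $y>p-\varepsilon$ (both bits are correct when $|y-p|<\varepsilon$). $m$-reducibility: for $f,g:2^\omega\to\mathbb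 R$, $f\le_{\mathbf m} g$ means: for every $p\in\mathbb Q,\varepsilon\in\mathbb Q^+$ there are $q\in\mathbb Q,\delta\in\mathbb Q^+$ and a continuous $k:2^\omega\to2^\omega$ such that for every $A\in2^\omega$, every correct answer to $g(k(A))\lesssim_\delta q$ is a correct answer to $f(A)\lesssim_\varepsilon p$. *)

(* Defs.v *)
From Stdlib Require Import Reals QArith Lra Lia Arith ClassicalEpsilon.
From Stdlib Require Import Rtopology.
Open Scope nat_scope.

Definition Cantor := nat -> bool.

Definition pair (x y : nat) : nat := ((x + y) * (x + y + 1) / 2 + y)%nat.
Definition unpair_step (p : nat * nat) : nat * nat :=
  match p with
  | (O, y) => (S y, O)
  | (S x, y) => (x, S y)
  end.
Definition unpair (n : nat) : nat * nat := Nat.iter n unpair_step (0, 0)%nat.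

Definition join (A Z : Cantor) : Cantor :=
  fun n => if Nat.even n then A (Nat.div2 n) else Z (Nat.div2 n).

Inductive prog : Type :=
| pZero | pSucc | pId | pFst | pSnd | pOracle
| pComp (f g : prog)
| pPair (f g : prog)
| pRec (f g : prog)
| pMu (f : prog).

Inductive eval (X : Cantor) : prog -> nat -> nat -> Prop :=
| ev_zero x : eval X pZero x 0
| ev_succ x : eval X pSucc x (S x)
| ev_id x : eval X pId x x
| ev_fst x : eval X pFst x (fst (unpair x))
| ev_snd x : eval X pSnd x (snd (unpair x))
| ev_oracle x : eval X pOracle x (if X x then 1%nat else 0%nat)
| ev_comp f g x y z : eval X g x y -> eval X f y z -> eval X (pComp f g) x z
| ev_pair f g x y1 y2 : eval X f x y1 -> eval X g x y2 -> eval X (pPair f g) x (pair y1 y2)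
| ev_rec0 f g x y : eval X f x y -> eval X (pRec f g) (pair x 0) y
| ev_recS f g x k r y : eval X (pRec f g) (pair x k) r ->
    eval X g (pair (pair x k) r) y -> eval X (pRec f g) (pair x (S k)) y
| ev_mu f x n : eval X f (pair x n) 0 ->
    (forall m, (m < n)%nat -> exists k, eval X f (pair x m) (S k)) ->
    eval X (pMu f) x n.

Fixpoint code (p : prog) : nat :=
  match p with
  | pZero => pair 0 0
  | pSucc => pair 1 0
  | pId => pair 2 0
  | pFst => pair 3 0
  | pSnd => pair 4 0
  | pOracle => pair 5 0
  | pComp f g => pair 6 (pair (code f) (code g))
  | pPair f g => pair 7 (pair (code f) (code g))
  | pRec f g => pair 8 (pair (code f) (code g))
  | pMu f => pair 9 (code f)
  end.

Definition phi (X : Cantor) (e x y : nat) : Prop :=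
  exists p, code p = e /\ eval X p x y.

Definition tobool (S : nat -> Prop) : Cantor :=
  fun n => if excluded_middle_informative (S n) then true else false.

Definition jump (X : Cantor) : nat -> Prop := fun e => exists y, phi X e e y.

Fixpoint jumpn (X : Cantor) (n : nat) : nat -> Prop :=
  match n with
  | O => fun i => X i = true
  | S m => jump (tobool (jumpn X m))
  end.

(** * Countable ordinals (Brouwer trees) *)
Inductive Ord : Type :=
| OZ : Ord
| OS : Ord -> Ord
| OL : (nat -> Ord) -> Ord.   (* supremum of a sequence *)

Inductive ole : Ord -> Ord -> Prop :=
| ole_Z y : ole OZ y
| ole_S x y : olt x y -> ole (OS x) y
| ole_L f y : (forall n, ole (f n) y) -> ole (OL f) y
with olt : Ord -> Ord -> Prop :=
| olt_S x y : ole x y -> olt x (OS y)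
| olt_L x g n : olt x (g n) -> olt x (OL g).

Definition oeq (x y : Ord) : Prop := ole x y /\ ole y x.

Fixpoint ofin (n : nat) : Ord :=
  match n with O => OZ | S m => OS (ofin m) end.

Inductive inO (Z : Cantor) : nat -> Prop :=
| O_one : inO Z 1
| O_succ b : inO Z b -> inO Z (2 ^ b)
| O_lim e : (forall n, exists m k, phi Z e n m /\ phi Z e (S n) k /\ ltO Z m k) ->
    inO Z (3 * 5 ^ e)
with ltO (Z : Cantor) : nat -> nat -> Prop :=
| ltO_succ b : inO Z b -> ltO Z b (2 ^ b)
| ltO_lim e n m : inO Z (3 * 5 ^ e) -> phi Z e n m -> ltO Z m (3 * 5 ^ e)
| ltO_trans a b c : ltO Z a b -> ltO Z b c -> ltO Z a c.

Inductive rankO (Z : Cantor) : nat -> Ord -> Prop :=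
| rk_one : rankO Z 1 OZ
| rk_succ b o : inO Z b -> rankO Z b o -> rankO Z (2 ^ b) (OS o)
| rk_lim e (f : nat -> Ord) : inO Z (3 * 5 ^ e) ->
    (forall n m, phi Z e n m -> rankO Z m (f n)) -> rankO Z (3 * 5 ^ e) (OL f).

Inductive Hrel (Z X : Cantor) : nat -> (nat -> Prop) -> Prop :=
| H_one : Hrel Z X 1 (fun n => X n = true)
| H_succ b S : inO Z b -> Hrel Z X b S -> Hrel Z X (2 ^ b) (jump (tobool S))
| H_lim e (Hs : nat -> nat -> Prop) : inO Z (3 * 5 ^ e) ->
    (forall u, ltO Z u (3 * 5 ^ e) -> Hrel Z X u (Hs u)) ->
    Hrel Z X (3 * 5 ^ e)
      (fun n => ltO Z (fst (unpair n)) (3 * 5 ^ e) /\ Hs (fst (unpair n)) (snd (unpair n))).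

Definition Hset (Z X : Cantor) (b : nat) : nat -> Prop :=
  fun i => exists S, Hrel Z X b S /\ S i.

Definition jumpset (Z : Cantor) (a : nat) (A : Cantor) : nat -> Prop :=
  fun i =>
    (exists n o, rankO Z a o /\ oeq o (ofin n) /\ jumpn (join A Z) n i) \/
    ((~ exists n o, rankO Z a o /\ oeq o (ofin n)) /\ Hset Z (join A Z) (2 ^ a) i).

Definition setreal (P : nat -> Prop) : R :=
  epsilon (inhabits 0%R)
    (fun y => infinite_sum
       (fun i => if excluded_middle_informative (P i) then (/ 2 ^ (S i))%R else 0%R) y).

Definition jfun (Z : Cantor) (a : nat) : Cantor -> R :=
  fun A => setreal (jumpset Z a A).

Open Scope R_scope.

Definition agree (A B : Cantor) (n : nat) : Prop :=
  forall i, (i < n)%nat -> A i = B i.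

Definition cont_real (f : Cantor -> R) : Prop :=
  forall A eps, eps > 0 -> exists n, forall B, agree A B n -> Rabs (f A - f B) < eps.

Definition cont_cantor (k : Cantor -> Cantor) : Prop :=
  forall A n, exists m, forall B, agree A B m -> agree (k A) (k B) n.

Inductive baire : Ord -> (Cantor -> R) -> Prop :=
| baire_cont al f : cont_real f -> baire al f
| baire_lim al f (g : nat -> Cantor -> R) :
    (forall n, exists be, olt be al /\ baire be (g n)) ->
    (forall A, Un_cv (fun n => g n A) (f A)) -> baire al f.

Inductive borel_set : (Cantor -> Prop) -> Prop :=
| bs_cyl (s : list bool) :
    borel_set (fun A => forall i, (i < length s)%nat -> A i = List.nth i s false)
| bs_compl S : borel_set S -> borel_set (fun A => ~ S A)
| bs_union (S : nat -> Cantor -> Prop) : (forall n, borel_set (S n)) ->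
    borel_set (fun A => exists n, S n A)
| bs_ext S T : (forall A, S A <-> T A) -> borel_set S -> borel_set T.

Definition borel_fun (f : Cantor -> R) : Prop :=
  forall U : R -> Prop, open_set U -> borel_set (fun A => U (f A)).

Definition correct (b : bool) (y : R) (p eps : Q) : Prop :=
  (b = true /\ y < Q2R p + Q2R eps) \/ (b = false /\ y > Q2R p - Q2R eps).

Definition mred (f g : Cantor -> R) : Prop :=
  forall p eps : Q, (0 < eps)%Q ->
    exists (q delta : Q) (k : Cantor -> Cantor),
      (0 < delta)%Q /\ cont_cantor k /\
      forall A b, correct b (g (k A)) q delta -> correct b (f A) p eps.

(* Main.v *)
(* A map [k] answering the questions about [j] from those about [f] is a reduction of the
   pair ([j > p], [j <= p]) to the pair ([f >= q + delta], [f <= q - delta]).  The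
   corresponding Wadge game, in which one player builds [A] and the other [k(A)], has a Borel
   payoff, so by Martin's theorem either [k] exists or the first player has a winning
   strategy; the latter is a continuous [k'] whose preimage of [j > p], a countable union of
   sets with indicator in the class [al], separates [f <= q - delta] from [f >= q + delta].  If neither [j] nor
   [-j] reduces to [f], this happens for all [q], [delta] and for both orders of the two sets,
   so the value of [f] can be found with any precision by an unbounded search over tests of
   class [al], and hence [f] is in the class [al].

   Borel determinacy is proved by unraveling: a covering of a game tree transfers strategies
   downwards and lifts plays upwards; open sets are made clopen by a covering in which the
   players announce quasi-strategies, and countable unions are treated by passing to the
   inverse limit of a tower of coverings. *)

Require Import Defs.
From Stdlib Require Import Reals QArith.
From Stdlib Require Cantor.
From Stdlib Require Import Lra Lia Arith ZArith List Bool Classical ClassicalEpsilon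
  FunctionalExtensionality PropExtensionality ProofIrrelevance Wf_nat.
Import ListNotations.

Open Scope nat_scope.

(** * Game trees and coverings *)

(** Only a game on [word_tree] is needed in the end, yet unraveling is proved for every tree and
    every [k]. In a countable union the [n]-th set is unraveled on the tree that the earlier
    coverings produced, and its covering has to leave the levels up to [k + n] unchanged, so that
    every level of the tower is eventually constant and a limit exists. On the side of the classes,
    the danger is that the search for the value of [f] ends one class too high. It is avoided by
    approximating with sequences that are eventually constant at each point: every function of
    finitely many such values, continuous or not, passes to the limit. Stage [n] of the search can
    therefore consult the [n]-th approximations of the tests, which lie in classes below [al], in
    place of the tests themselves, and a single limit remains to be taken. *)

Record Tree := {
  node :> Type;
  lev : node -> nat;
  par : node -> node;
  root : node;
  lev_root : lev root = 0;
  lev_zero : forall v, lev v = 0 -> v = root;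
  lev_par : forall v, lev (par v) = pred (lev v);
  extendible : forall v, exists w, lev w = S (lev v) /\ par w = v }.

Arguments lev {_}.
Arguments par {_}.
Arguments root {_}.

Section TreeBasics.
Context {G : Tree}.
Implicit Types (v w : G) (x : nat -> G) (s : G -> G).

Definition child v w := lev w = S (lev v) /\ par w = v.
Definition anc n v := Nat.iter (lev v - n) par v.
Definition run x := x 0 = root /\ forall n, child (x n) (x (S n)).
Definition strat s := forall v, child v (s v).
(* [i = true] is the player moving at even levels. *)
Definition follows (i : bool) s x := forall n, Nat.even n = i -> x (S n) = s (x n).
Definition agree_upto (i : bool) n s t :=
  forall v, Nat.even (lev v) = i -> lev v <= n -> s v = t v.

Definition some_child v : G := epsilon (inhabits root) (child v).

Lemma some_child_spec v : child v (some_child v).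
Proof. unfold some_child. apply epsilon_spec, extendible. Qed.

(** Turns any function on nodes into a strategy: junk answers, such as unspecified values of
    [epsilon], are replaced by some child. *)
Definition force_child v w : G :=
  if excluded_middle_informative (child v w) then w else some_child v.

Lemma force_child_spec v w : child v (force_child v w).
Proof.
  unfold force_child; destruct excluded_middle_informative; auto.
  apply some_child_spec.
Qed.

Lemma force_child_eq v w : child v w -> force_child v w = w.
Proof. unfold force_child; destruct excluded_middle_informative; tauto. Qed.

Lemma lev_iter_par m v : lev (Nat.iter m par v) = lev v - m.
Proof. induction m; simpl; [lia|]. rewrite lev_par, IHm. lia. Qed.

Lemma lev_anc n v : lev (anc n v) = Nat.min n (lev v).
Proof. unfold anc. rewrite lev_iter_par. lia. Qed.

Lemma anc_id n v : lev v <= n -> anc n v = v.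
Proof. unfold anc. intro. replace (lev v - n) with 0 by lia. reflexivity. Qed.

Lemma anc_child n v w : child v w -> n <= lev v -> anc n w = anc n v.
Proof.
  intros [E1 E2] L. unfold anc. rewrite E1.
  replace (S (lev v) - n) with (S (lev v - n)) by lia.
  rewrite Nat.iter_succ_r, E2. reflexivity.
Qed.

Lemma anc_step n v : S n <= lev v -> child (anc n v) (anc (S n) v).
Proof.
  intro L. split; [rewrite !lev_anc; lia|].
  unfold anc. replace (lev v - n) with (S (lev v - S n)) by lia. reflexivity.
Qed.

Lemma run_lev x : run x -> forall n, lev (x n) = n.
Proof.
  intros [R0 R] n; induction n; [rewrite R0; apply lev_root|].
  destruct (R n) as [E _]. congruence.
Qed.

Lemma run_anc x n m : run x -> n <= m -> anc n (x m) = x n.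
Proof.
  intros R L. induction L.
  - apply anc_id. rewrite (run_lev x R). lia.
  - rewrite <- IHL. apply anc_child; [apply R|]. rewrite (run_lev x R). lia.
Qed.

Lemma strat_some_child : strat some_child.
Proof. intro v; apply some_child_spec. Qed.

End TreeBasics.

Arguments child {G}.
Arguments anc {G}.
Arguments run {G}.
Arguments strat {G}.

(** A [k]-covering. The inverse limit rests on [tr_local] and [tr_below]: a transferred strategy at
    level [n] depends only on the levels up to [n] of the given one, and below level [k] the
    transfer is just relabelling by [pi]. *)
Record Cov (k : nat) (G H : Tree) := {
  pi : H -> G;
  pi_lev : forall v, lev (pi v) = lev v;
  pi_par : forall v, par (pi v) = pi (par v);
  pi_inj : forall v w, lev v <= k -> pi v = pi w -> v = w;
  pi_surj : forall v, lev v <= k -> exists w, pi w = v;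
  tr : bool -> (H -> H) -> (G -> G);
  tr_strat : forall i s, strat s -> strat (tr i s);
  tr_local : forall i n s t, strat s -> strat t ->
    agree_upto i n s t -> agree_upto i n (tr i s) (tr i t);
  tr_below : forall i s w, strat s -> Nat.even (lev w) = i -> lev w < k ->
    tr i s (pi w) = pi (s w);
  tr_lift : forall i s x, strat s -> run x -> follows i (tr i s) x ->
    exists y, run y /\ follows i s y /\ forall n, pi (y n) = x n }.

Arguments pi {k G H} _ _.
Arguments tr {k G H} _ _ _.

Section Covers.

Lemma pi_child {k G H} (C : Cov k G H) v w : child v w -> child (pi C v) (pi C w).
Proof.
  intros [E1 E2]. split; [now rewrite !pi_lev|]. now rewrite pi_par, E2.
Qed.

Lemma pi_run {k G H} (C : Cov k G H) x : run x -> run (fun n => pi C (x n)).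
Proof.
  intros [R0 R]. split; [|intro; apply pi_child, R].
  apply lev_zero. rewrite pi_lev, R0. apply lev_root.
Qed.

Definition cov_id k (G : Tree) : Cov k G G.
Proof.
  refine {| pi := fun v => v; tr := fun _ s => s |}; auto.
  - intros v _. now exists v.
  - intros i s x _ R F. now exists x.
Defined.

Definition cov_comp {k G H K} (C : Cov k G H) (D : Cov k H K) : Cov k G K.
Proof.
  refine {| pi := fun v => pi C (pi D v); tr := fun i s => tr C i (tr D i s) |}.
  - intro; now rewrite !pi_lev.
  - intro; now rewrite !pi_par.
  - intros v w L E. apply (pi_inj _ _ _ D); auto. apply (pi_inj _ _ _ C); auto.
    now rewrite pi_lev.
  - intros v L. destruct (pi_surj _ _ _ C v L) as [w Ew].
    destruct (pi_surj _ _ _ D w) as [u Eu]; [|exists u; congruence].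
    rewrite <- (pi_lev _ _ _ C), Ew; auto.
  - intros i s Hs. now do 2 apply tr_strat.
  - intros i n s t Hs Ht A. apply tr_local; try now apply tr_strat. now apply tr_local.
  - intros i s w Hs Hi L. rewrite tr_below.
    + now rewrite tr_below.
    + now apply tr_strat.
    + now rewrite pi_lev.
    + now rewrite pi_lev.
  - intros i s x Hs R F.
    destruct (tr_lift _ _ _ C i _ x (tr_strat _ _ _ D i s Hs) R F) as (y & Ry & Fy & Ey).
    destruct (tr_lift _ _ _ D i s y Hs Ry Fy) as (z & Rz & Fz & Ez).
    exists z. repeat split; try apply Rz; auto. intro n. now rewrite Ez, Ey.
Defined.

Definition cov_weaken {k l G H} (L : l <= k) (C : Cov k G H) : Cov l G H.
Proof.
  refine {| pi := pi C; tr := tr C |}; intros.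
  - apply pi_lev.
  - apply pi_par.
  - apply (pi_inj _ _ _ C); auto; lia.
  - apply (pi_surj _ _ _ C); lia.
  - now apply tr_strat.
  - now apply tr_local.
  - apply tr_below; auto; lia.
  - now apply tr_lift.
Defined.

End Covers.

(** * Reachability games *)

Section Reach.
Context {G : Tree} (i : bool) (dom goal : G -> Prop).

Inductive Win : G -> Prop :=
| Win_goal v : goal v -> Win v
| Win_own v w : Nat.even (lev v) = i -> child v w -> dom w -> Win w -> Win v
| Win_opp v : Nat.even (lev v) <> i ->
    (forall w, child v w -> dom w -> Win w) -> Win v.

(** The strategy has to be obeyed only until the goal is met, because the transferred strategies of
    the unraveling switch to another rule at that moment. *)
Definition wins_from (v : G) (s : G -> G) := strat s /\
  forall x, run x -> x (lev v) = v ->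
    (forall m, lev v <= m -> (forall l, lev v <= l <= m -> ~ goal (x l)) ->
       Nat.even m = i -> x (S m) = s (x m)) ->
    exists m, lev v <= m /\ goal (x m) /\ forall l, lev v <= l <= m -> dom (x l).

Context (dom_opp : forall v w, dom v -> Nat.even (lev v) <> i -> child v w -> dom w).

Lemma Win_strategy v : Win v -> dom v -> exists s, wins_from v s.
Proof.
  induction 1 as [v Hg|v w Ev Hc Hw _ IH|v Ev Hall IH]; intro Hv.
  - exists some_child. split; [apply strat_some_child|]. intros x R E _.
    exists (lev v). rewrite E. repeat split; auto.
    intros l Hl. replace l with (lev v) by lia. now rewrite E.
  - destruct (IH Hw) as (s & Hs & W).
    exists (fun u => if excluded_middle_informative (u = v) then w else s u).
    split.
    { intro u. destruct excluded_middle_informative; [now subst|apply Hs]. }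
    intros x R E F.
    destruct (classic (goal v)) as [Hg|Hg].
    { exists (lev v). rewrite E. repeat split; auto.
      intros l Hl. replace l with (lev v) by lia. now rewrite E. }
    destruct Hc as [Lw Pw].
    assert (Ew : x (S (lev v)) = w).
    { rewrite F; auto.
      - rewrite E. destruct excluded_middle_informative; tauto.
      - intros l Hl. replace l with (lev v) by lia. now rewrite E. }
    destruct (W x R) as (m & Lm & Gm & Dm).
    { now rewrite Lw. }
    { rewrite Lw. intros m Lm Hm Em. rewrite F; auto; [|lia|].
      - destruct excluded_middle_informative as [E'|]; auto.
        apply (f_equal lev) in E'. rewrite (run_lev x R) in E'. lia.
      - intros l Hl. destruct (Nat.eq_dec l (lev v)) as [->|]; [now rewrite E|].
        apply Hm. lia. }
    exists m. split; [lia|]. split; auto. intros l Hl.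
    destruct (Nat.eq_dec l (lev v)) as [->|]; [now rewrite E|]. apply Dm. lia.
  - set (f := fun c => epsilon (inhabits (@some_child G)) (wins_from c)).
    assert (Hf : forall c, child v c -> wins_from c (f c)).
    { intros c Hc. unfold f. apply epsilon_spec, IH; auto; now apply (dom_opp v). }
    (* The strategies chosen for the children are glued: the ancestor of [u] just above [v] tells
       which child the play went through. *)
    exists (fun u => force_child u (f (anc (S (lev v)) u) u)).
    split; [intro; apply force_child_spec|].
    intros x R E F.
    destruct (classic (goal v)) as [Hg|Hg].
    { exists (lev v). rewrite E. repeat split; auto.
      intros l Hl. replace l with (lev v) by lia. now rewrite E. }
    set (c := x (S (lev v))).
    assert (Hc : child v c).
    { unfold c. rewrite <- E at 1. apply R. }
    destruct (Hf c Hc) as (Hs & W).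
    assert (Lc : lev c = S (lev v)) by apply Hc.
    destruct (W x R) as (m & Lm & Gm & Dm).
    { now rewrite Lc. }
    { rewrite Lc. intros m Lm Hm Em. rewrite F; auto; [|lia|].
      - rewrite run_anc by (auto; lia). apply force_child_eq, Hs.
      - intros l Hl. destruct (Nat.eq_dec l (lev v)) as [->|]; [now rewrite E|].
        apply Hm. lia. }
    exists m. split; [lia|]. split; auto. intros l Hl.
    destruct (Nat.eq_dec l (lev v)) as [->|]; [now rewrite E|]. apply Dm. lia.
Qed.

Lemma not_Win_opp v : ~ Win v -> Nat.even (lev v) <> i ->
  exists w, child v w /\ dom w /\ ~ Win w.
Proof.
  intros N E. apply NNPP. intro H. apply N, Win_opp; auto.
  intros w Hc Hd. apply NNPP. intro. apply H. eauto.
Qed.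

Definition win_strat v := epsilon (inhabits (@some_child G)) (wins_from v).

Lemma win_strat_spec v : Win v -> dom v -> wins_from v (win_strat v).
Proof. intros. unfold win_strat. now apply epsilon_spec, Win_strategy. Qed.

End Reach.

(** * Inverse limits of coverings *)

Record thread (G : nat -> Tree) (p : forall j, G (S j) -> G j) := {
  at_ :> forall j, G j;
  thread_eq : forall j, p j (at_ (S j)) = at_ j }.

Arguments at_ {G p}.
Arguments thread_eq {G p}.

Lemma thread_ext G p (t u : thread G p) : (forall j, t j = u j) -> t = u.
Proof.
  destruct t as [t Ht], u as [u Hu]; simpl. intro E.
  assert (t = u) as -> by now apply functional_extensionality_dep.
  f_equal. apply proof_irrelevance.
Qed.

(** Coordinates after [J] come from surjectivity on low levels, those before [J] from projection.
    The free bound [c] lets the induction shift the tower without transport between the indices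
    [k + S j] and [S k + j]. *)
Lemma thread_through : forall J k (c : nat -> nat) (G : nat -> Tree)
  (C : forall j, Cov (c j) (G j) (G (S j))) (v : G J),
  (forall j, k + j <= c j) -> lev v <= k + J ->
  exists t : thread G (fun j => pi (C j)), t J = v.
Proof.
  induction J as [|J IH]; intros k c G C v Hc L.
  - set (up := fun j (w : G j) => epsilon (inhabits root) (fun u => pi (C j) u = w)).
    set (t := fix t j : G j := match j with 0 => v | S j => up j (t j) end).
    assert (U : forall j (w : G j), lev w <= k -> pi (C j) (up j w) = w).
    { intros j w Lw. unfold up. apply epsilon_spec. apply (pi_surj _ _ _ (C j)).
      specialize (Hc j). lia. }
    assert (Lt : forall j, lev (t j) <= k).
    { induction j; simpl; [lia|]. rewrite <- (pi_lev _ _ _ (C j)), U; auto. }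
    assert (Ht : forall j, pi (C j) (t (S j)) = t j) by (intro j; simpl; auto).
    exists (Build_thread G (fun j => pi (C j)) t Ht). reflexivity.
  - destruct (IH (S k) (fun j => c (S j)) (fun j => G (S j)) (fun j => C (S j)) v) as [t Ht].
    { intro j. specialize (Hc (S j)). lia. }
    { lia. }
    set (u := fun j => match j return G j with 0 => pi (C 0) (t 0) | S j => t j end).
    assert (Hu : forall j, pi (C j) (u (S j)) = u j).
    { intros [|j]; simpl; auto. apply (thread_eq t). }
    exists (Build_thread G (fun j => pi (C j)) u Hu). exact Ht.
Qed.

Section Limit.
Context (k : nat) (G : nat -> Tree) (C : forall j, Cov (k + j) (G j) (G (S j))).

Let T := thread G (fun j => pi (C j)).
Implicit Types t u : T.

Lemma thread_lev t j : lev (t j) = lev (t 0).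
Proof.
  induction j; auto. rewrite <- (thread_eq t j), pi_lev in IHj. exact IHj.
Qed.

(** From [J] on, all maps are injective at this level; before [J], coordinates are projections of
    the [J]-th. *)
Lemma thread_inj t u J : lev (t 0) <= k + J -> t J = u J -> t = u.
Proof.
  intros L E. apply thread_ext.
  assert (Up : forall d, t (d + J) = u (d + J)).
  { induction d; auto. simpl. apply (pi_inj _ _ _ (C (d + J))).
    - rewrite thread_lev. lia.
    - rewrite (thread_eq t), (thread_eq u). exact IHd. }
  assert (Down : forall d j, t (d + j) = u (d + j) -> t j = u j).
  { induction d; auto. simpl. intros j Ej. apply IHd.
    rewrite <- (thread_eq t), <- (thread_eq u). now f_equal. }
  intro j. apply (Down J). rewrite Nat.add_comm. apply Up.
Qed.

Definition thread_root : T.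
Proof.
  exists (fun j => root). intro j. apply lev_zero. rewrite pi_lev. apply lev_root.
Defined.

Definition thread_par (t : T) : T.
Proof.
  exists (fun j => par (t j)). intro j. rewrite <- pi_par. f_equal. apply (thread_eq t).
Defined.

Definition limit_tree : Tree.
Proof.
  refine {| node := T; lev := fun t => lev (t 0); par := thread_par; root := thread_root |}.
  - apply lev_root.
  - intros t L. apply (thread_inj _ _ 0); [lia|]. now apply lev_zero.
  - intro t. apply lev_par.
  (* The level of the extension is [J], so its coordinate [J] determines the whole thread. *)
  - intro t. set (J := S (lev (t 0))).
    destruct (extendible _ (t J)) as [w [Lw Pw]].
    destruct (thread_through J k _ G C w) as [u Hu]; [auto|rewrite Lw, thread_lev; lia|].
    fold T in u. exists u. rewrite <- (thread_lev u J), Hu, Lw, thread_lev. split; auto.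
    apply (thread_inj _ _ J); simpl.
    + rewrite lev_par, <- (thread_lev u J), Hu, Lw, thread_lev. simpl. lia.
    + congruence.
Defined.

Definition thread_of j (v : G j) : T :=
  epsilon (inhabits thread_root) (fun t => t j = v).

Lemma thread_of_at t j : lev (t 0) <= k + j -> thread_of j (t j) = t.
Proof.
  intro L. assert (E : thread_of j (t j) j = t j).
  { unfold thread_of. apply (epsilon_spec (inhabits thread_root) (fun u => u j = t j)).
    now exists t. }
  apply (thread_inj _ _ j); auto. rewrite <- (thread_lev _ j), E, thread_lev. exact L.
Qed.

Lemma thread_of_spec j (v : G j) : lev v <= k + j -> thread_of j v j = v.
Proof.
  intro L. apply (epsilon_spec (inhabits thread_root) (fun t => t j = v)).
  apply (thread_through j k (fun j => k + j) G C v); auto.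
Qed.

Lemma thread_child t u : (forall j, child (t j) (u j)) <-> child (G := limit_tree) t u.
Proof.
  split.
  - intro H. split; [apply (H 0)|]. apply thread_ext. intro j. apply H.
  - intros [L E] j. simpl in L, E. split; [now rewrite (thread_lev t j), (thread_lev u j)|].
    rewrite <- E. reflexivity.
Qed.

(** The part of [s] that the [j]-th tree can express: below level [k + j] a node and its children
    each correspond to exactly one thread. Beyond that the child is arbitrary. *)
Definition level_part (s : T -> T) j (v : G j) : G j :=
  if lt_dec (lev v) (k + j) then s (thread_of j v) j else some_child v.

Fixpoint pushed (i : bool) (s : T -> T) d j : G j -> G j :=
  match d with
  | 0 => level_part s j
  | S d => tr (C j) i (pushed i s d (S j))
  end.

(** Values at levels below [k + j + d] no longer change when [d] grows, so [S (lev v)] transfers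
    already give the limit value at [v]. *)
Definition limit_tr i (s : T -> T) j (v : G j) : G j := pushed i s (S (lev v)) j v.

Lemma level_part_strat s j : strat (G := limit_tree) s -> strat (level_part s j).
Proof.
  intros Hs v. unfold level_part. destruct lt_dec; [|apply some_child_spec].
  rewrite <- (thread_of_spec j v) at 1 by lia. apply thread_child, Hs.
Qed.

Lemma pushed_strat i s d j : strat (G := limit_tree) s -> strat (pushed i s d j).
Proof.
  intro Hs. revert j. induction d; intro j; simpl; [now apply level_part_strat|].
  apply tr_strat, IHd.
Qed.

(** For [d = 0] this is [tr_below] of the [j]-th covering; [tr_local] then carries the agreement
    down the tower. *)
Lemma pushed_stable i s d j n : strat (G := limit_tree) s -> n < k + j + d ->
  agree_upto i n (pushed i s (S d) j) (pushed i s d j).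
Proof.
  intro Hs. revert j n. induction d; intros j n L.
  - simpl. intros v Ei Lv.
    destruct (thread_through j k _ G C v) as [t Et]; [auto|lia|]. subst v.
    rewrite thread_lev in Ei, Lv. rewrite <- (thread_eq t j) at 1.
    rewrite tr_below; [|now apply level_part_strat| |]; rewrite ?thread_lev; auto; [|lia].
    unfold level_part. rewrite (thread_lev t j), (thread_lev t (S j)).
    destruct lt_dec; [|lia]. destruct lt_dec; [|lia].
    rewrite !thread_of_at by lia. apply (thread_eq (s t)).
  - simpl. apply tr_local; try apply (pushed_strat i s (S d)); try apply pushed_strat; auto.
    apply IHd. lia.
Qed.

Lemma pushed_limit i s d j (v : G j) : strat (G := limit_tree) s ->
  Nat.even (lev v) = i -> lev v < d -> pushed i s d j v = limit_tr i s j v.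
Proof.
  intros Hs Ei L. unfold limit_tr. induction L; auto.
  rewrite <- IHL. apply (pushed_stable i s m j (lev v)); auto. lia.
Qed.

Lemma limit_tr_strat i s j : strat (G := limit_tree) s -> strat (limit_tr i s j).
Proof. intros Hs v. now apply pushed_strat. Qed.

(** This coherence lets a play be lifted through the tower one covering at a time. *)
Lemma limit_tr_step i s j (v : G j) : strat (G := limit_tree) s -> Nat.even (lev v) = i ->
  limit_tr i s j v = tr (C j) i (limit_tr i s (S j)) v.
Proof.
  intros Hs Ei. rewrite <- (pushed_limit i s (S (S (lev v)))) by (auto; lia).
  apply (tr_local _ _ _ (C j) i (lev v)); auto; try now apply limit_tr_strat.
  { apply (pushed_strat i s (S (lev v)) (S j) Hs). }
  intros w Ew Lw. apply (pushed_limit i s (S (lev v)) (S j)); auto. lia.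
Qed.

Lemma limit_tr_below i s t j : strat (G := limit_tree) s -> Nat.even (lev (t 0)) = i ->
  lev (t 0) < k + j -> limit_tr i s j (t j) = s t j.
Proof.
  intros Hs Ei L.
  assert (E : forall d, pushed i s d j (t j) = level_part s j (t j)).
  { induction d; auto. rewrite <- IHd.
    apply (pushed_stable i s d j (lev (t 0))); auto; rewrite ?thread_lev; auto. lia. }
  unfold limit_tr. rewrite E. unfold level_part. rewrite thread_lev.
  destruct lt_dec; [|lia]. now rewrite thread_of_at by lia.
Qed.

Lemma pushed_local i n s s' d j : agree_upto (G := limit_tree) i n s s' ->
  strat (G := limit_tree) s -> strat (G := limit_tree) s' ->
  agree_upto i n (pushed i s d j) (pushed i s' d j).
Proof.
  intros A Hs Hs'. revert j. induction d; intro j; simpl.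
  - intros v Ei Lv. unfold level_part. destruct lt_dec; auto.
    destruct (thread_through j k _ G C v) as [t Et]; [auto|lia|]. subst v.
    rewrite thread_lev in Ei, Lv. rewrite thread_of_at by (rewrite <- (thread_lev t j); lia).
    now rewrite A.
  - apply tr_local; auto; now apply pushed_strat.
Qed.

Lemma limit_lift i s x : strat (G := limit_tree) s -> run x -> follows i (limit_tr i s 0) x ->
  exists y, run (G := limit_tree) y /\ follows (G := limit_tree) i s y /\ forall n, y n 0 = x n.
Proof.
  intros Hs R F.
  set (good := fun j (z : nat -> G j) => run z /\ follows i (limit_tr i s j) z).
  assert (St : forall j z, good j z -> exists z', good (S j) z' /\ forall n, pi (C j) (z' n) = z n).
  { intros j z [Rz Fz].
    destruct (tr_lift _ _ _ (C j) i (limit_tr i s (S j)) z) as (z' & Rz' & Fz' & E).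
    - now apply limit_tr_strat.
    - exact Rz.
    - intros n En. rewrite Fz by auto. apply limit_tr_step; auto. now rewrite (run_lev z Rz).
    - exists z'. split; [split|]; auto. }
  set (next := fun j (z : nat -> G j) => epsilon (inhabits (fun _ => root))
         (fun z' => good (S j) z' /\ forall n, pi (C j) (z' n) = z n)).
  set (Z := fix Z j : nat -> G j := match j with 0 => x | S j => next j (Z j) end).
  assert (HZ : forall j, good j (Z j) /\ forall n, pi (C j) (Z (S j) n) = Z j n).
  { assert (N : forall j z, good j z -> good (S j) (next j z) /\ forall n, pi (C j) (next j z n) = z n).
    { intros j z Hz. unfold next. apply epsilon_spec. auto. }
    assert (HZ : forall j, good j (Z j)).
    { induction j; [now split|]. apply (N j (Z j)); auto. }
    intro j. split; auto. apply (N j (Z j)); auto. }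
  set (y := fun n => Build_thread G (fun j => pi (C j)) (fun j => Z j n) (fun j => proj2 (HZ j) n)).
  assert (Ry : run (G := limit_tree) y).
  { split.
    - apply thread_ext. intro j. apply HZ.
    - intro n. apply thread_child. intro j. apply HZ. }
  exists y. split; auto. split; [|reflexivity].
  intros n En.
  assert (Ln : lev (y n 0) = n) by apply (run_lev (G := limit_tree) y Ry).
  (* Coordinate [S n] suffices: level [n] is below [k + S n], where [limit_tr] returns the
     coordinate of [s] itself. *)
  apply (thread_inj _ _ (S n)).
  - pose proof (run_lev (G := limit_tree) y Ry (S n)) as Ls. simpl in Ls. simpl. lia.
  - rewrite <- (limit_tr_below i) by (rewrite ?Ln; auto; lia).
    apply HZ. exact En.
Qed.

Definition limit_cov : Cov k (G 0) limit_tree.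
Proof.
  refine {| pi := (fun t => t 0) : limit_tree -> G 0;
            tr := fun i s => limit_tr i s 0 |}.
  - reflexivity.
  - reflexivity.
  - intros t u L E. apply (thread_inj _ _ 0); auto. simpl in L. lia.
  - intros v L. destruct (thread_through 0 k _ G C v) as [t Ht]; [auto|lia|]. now exists t.
  - intros. now apply limit_tr_strat.
  - intros i n s s' Hs Hs' A v Ei Lv. now apply (pushed_local i n).
  - intros i s t Hs Ei L. apply limit_tr_below; auto. simpl in L. lia.
  - intros i s x Hs R F. now apply limit_lift.
Defined.

End Limit.

(** * Unraveling an open set *)

Section Least.
Context (P : nat -> Prop).

Definition is_least n := P n /\ forall m, P m -> n <= m.
Definition least := epsilon (inhabits 0) is_least.

Lemma exists_least : (exists n, P n) -> exists n, is_least n.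
Proof.
  intros [n Hn]. induction n as [n IH] using lt_wf_ind.
  destruct (classic (exists m, m < n /\ P m)) as [(m & L & Hm)|N]; [now apply (IH m)|].
  exists n. split; auto. intros m Hm. apply Nat.nlt_ge. intro. apply N. eauto.
Qed.

Lemma least_eq n : is_least n -> least = n.
Proof.
  intro H. assert (H' : is_least least) by (unfold least; apply epsilon_spec; eauto).
  apply Nat.le_antisymm; [apply H', H|apply H, H'].
Qed.

End Least.

Section Unravel.
Context {G : Tree} (k : nat) (O : G -> Prop).
Context (k_even : Nat.even k = true) (O_up : forall v w, O v -> child v w -> O w).

(** [free] and [no_claim] are placeholders that [legal] prescribes before the announcements;
    prescribing them makes the projection injective on the levels up to [k]. *)
Definition free : G -> Prop := fun _ => True.
Definition no_claim : G + (G -> Prop) := inr free.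

(* Quasi-strategies are given as sets of nodes; only the nodes above the current position
   matter, so they need not be closed under [par]. *)
Definition qstratI (q : G) (a : G -> Prop) :=
  a q /\
  (forall v w, a v -> Nat.even (lev v) = false -> child v w -> a w) /\
  (forall v, a v -> Nat.even (lev v) = true -> exists w, child v w /\ a w).

Definition qstratII (a b : G -> Prop) :=
  (forall v, b v -> a v /\ ~ O v) /\
  (forall v w, b v -> Nat.even (lev v) = true -> child v w -> a w -> b w) /\
  (forall v, b v -> Nat.even (lev v) = false -> exists w, child v w /\ b w).

(** One of the two nodes is an ancestor of the other, because [anc n] fixes every node of level at
    most [n]. *)
Definition compat (q u : G) := anc (lev q) u = anc (lev u) q.

(* At level [k] player I also announces a quasi-strategy [a]; at level [k + 1] player II
   either claims that the run will pass through a node [u] of [a] in [O], or announces a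
   quasi-strategy inside [a] avoiding [O]. *)
Definition legal (q : G) (a : G -> Prop) (c : G + (G -> Prop)) :=
  (lev q <= k -> a = free) /\ (lev q <= S k -> c = no_claim) /\
  (k < lev q -> qstratI (anc (S k) q) a) /\
  (S k < lev q -> match c with
    | inl u => compat q u /\ a u /\ O u /\ S k < lev u
    | inr b => (forall l, S k < l <= lev q -> b (anc l q)) /\ qstratII a b
    end).

Record pos := { at_node : G; qI : G -> Prop; claim : G + (G -> Prop);
                legal_pos : legal at_node qI claim }.

Lemma pos_ext (p q : pos) :
  at_node p = at_node q -> qI p = qI q -> claim p = claim q -> p = q.
Proof.
  destruct p, q; simpl. intros -> -> ->. f_equal. apply proof_irrelevance.
Qed.

Lemma qstratI_free q : qstratI q free.
Proof. repeat split. intros v _ _. destruct (extendible _ v) as [w Hw]. now exists w. Qed.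

Lemma legal_low q : lev q <= k -> legal q free no_claim.
Proof. intro L. repeat split; auto; intro; lia. Qed.

Definition cut {A} n m (d x : A) := if le_dec n m then d else x.

Lemma cut_low {A} n m (d x : A) : n <= m -> cut n m d x = d.
Proof. unfold cut. destruct le_dec; [auto|lia]. Qed.

Lemma cut_high {A} n m (d x : A) : m < n -> cut n m d x = x.
Proof. unfold cut. destruct le_dec; [lia|auto]. Qed.

Lemma compat_par q u : lev q <> 0 -> compat q u -> compat (par q) u.
Proof.
  unfold compat. intros Lq E.
  destruct (Nat.le_gt_cases (lev q) (lev u)) as [L|L].
  - rewrite (anc_id (lev u) q) in E by lia.
    rewrite (anc_id (lev u) (par q)) by (rewrite lev_par; lia).
    rewrite lev_par. rewrite <- E at 2. symmetry.
    destruct (lev q) as [|n]; [lia|]. apply (anc_step n u). lia.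
  - rewrite (anc_id (lev q) u) in E by lia. rewrite anc_id by (rewrite lev_par; lia).
    transitivity (anc (lev u) q); [exact E|]. apply anc_child; [|rewrite lev_par; lia].
    split; [rewrite lev_par; lia|reflexivity].
Qed.

Lemma legal_par q a c : legal q a c ->
  legal (par q) (cut (lev (par q)) k free a) (cut (lev (par q)) (S k) no_claim c).
Proof.
  intros (L1 & L2 & L3 & L4).
  assert (Hc : lev q <> 0 -> child (par q) q).
  { intro. split; [rewrite lev_par; lia|reflexivity]. }
  split; [|split; [|split]]; intro L; rewrite ?(cut_low _ _ _ _ L); auto.
  - rewrite cut_high by auto. rewrite lev_par in *.
    rewrite <- (anc_child (S k) (par q) q); [|apply Hc; lia|rewrite lev_par; lia].
    apply L3. lia.
  - rewrite !cut_high by lia. rewrite lev_par in L.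
    destruct c as [u|b].
    + destruct L4 as (K & ?); [lia|]. split; auto. apply compat_par; auto. lia.
    + destruct L4 as (K & Q); [lia|]. split; auto. intros l Hl. rewrite lev_par in Hl.
      rewrite <- (anc_child l (par q) q); [apply K; lia|apply Hc; lia|rewrite lev_par; lia].
Qed.

Definition pos_par (p : pos) : pos :=
  {| at_node := par (at_node p);
     qI := cut (lev (par (at_node p))) k free (qI p);
     claim := cut (lev (par (at_node p))) (S k) no_claim (claim p);
     legal_pos := legal_par _ _ _ (legal_pos p) |}.

Lemma root_low : lev (root : G) <= k.
Proof. rewrite lev_root. lia. Qed.

Definition pos_root : pos :=
  {| at_node := root; qI := free; claim := no_claim;
     legal_pos := legal_low root root_low |}.

Lemma odd_Sk : Nat.even (S k) = false.
Proof. rewrite Nat.even_succ, <- Nat.negb_even, k_even. reflexivity. Qed.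

Lemma legal_next q a c q' : legal q a c -> S k < lev q -> child q q' ->
  match c with inl u => compat q' u | inr b => b q' end -> legal q' a c.
Proof.
  intros (L1 & L2 & L3 & L4) L Hc M. pose proof (proj1 Hc) as E.
  split; [|split; [|split]]; intro; try lia.
  - rewrite (anc_child (S k) q q') by (auto; lia). apply L3. lia.
  - destruct c as [u|b]; [tauto|]. split; [|apply L4; auto].
    intros l Hl. destruct (Nat.eq_dec l (lev q')) as [->|].
    + now rewrite anc_id.
    + rewrite (anc_child l q q') by (auto; lia). apply L4; auto. lia.
Qed.

Lemma compat_above q q' u : compat q u -> lev u <= lev q -> child q q' -> compat q' u.
Proof.
  unfold compat. intros E L Hc. rewrite (anc_child (lev u) q q') by auto.
  rewrite <- E. pose proof (proj1 Hc). now rewrite !anc_id by lia.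
Qed.

Lemma compat_below q u : compat q u -> lev q <= lev u -> anc (lev q) u = q.
Proof. unfold compat. intros -> L. now apply anc_id. Qed.

Lemma legal_start q a c : lev q = S k -> qstratI q a -> c = no_claim -> legal q a c.
Proof.
  intros L Q E. split; [|split; [|split]]; intro; try lia; auto.
  now rewrite anc_id by lia.
Qed.

Lemma legal_claim q a c q' : legal q a no_claim -> lev q = S k -> child q q' ->
  match c with
  | inl u => compat q' u /\ a u /\ O u /\ S k < lev u
  | inr b => b q' /\ qstratII a b
  end -> legal q' a c.
Proof.
  intros (_ & _ & L3 & _) L Hc M. pose proof (proj1 Hc) as E.
  split; [|split; [|split]]; intro; try lia.
  - rewrite (anc_child (S k) q q') by (auto; lia). apply L3. lia.
  - destruct c as [u|b]; [tauto|]. split; [|apply M].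
    intros l Hl. replace l with (lev q') by lia. rewrite anc_id by lia. apply M.
Qed.

Lemma legal_extend q a c : legal q a c -> exists q' a' c', child q q' /\ legal q' a' c' /\
  (k < lev q -> a' = a) /\ (S k < lev q -> c' = c).
Proof.
  intros HL. pose proof HL as (L1 & L2 & L3 & L4).
  destruct (extendible _ q) as [q' Hq']. fold (child q q') in Hq'.
  pose proof (proj1 Hq') as Eq'.
  destruct (lt_eq_lt_dec (lev q) k) as [[L|L]|L].
  - exists q', free, no_claim. repeat split; try apply Hq'; try (intro; lia).
    all: apply legal_low; lia.
  - exists q', free, no_claim. split; auto. split; [|split; intro; lia].
    apply legal_start; auto; [lia|apply qstratI_free].
  - destruct (Nat.eq_dec (lev q) (S k)) as [Lq|Lq].
    + specialize (L3 L). rewrite anc_id in L3 by lia. destruct L3 as (A1 & A2 & A3).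
      rewrite L2 in HL by lia.
      assert (Aq' : a q') by (apply (A2 q); auto; rewrite Lq; apply odd_Sk).
      (* If no node of [a] beyond [q'] can be claimed, then the part of [a] beyond [q'] avoids [O]
         and is itself a legal announcement. *)
      destruct (classic (exists u, a u /\ O u /\ S k < lev u /\ anc (lev q') u = q'))
        as [(u & Au & Ou & Lu & Eu)|N].
      * exists q', a, (inl u). split; auto. split; [|split; [auto|intro; lia]].
        apply (legal_claim q); auto. repeat split; auto.
        unfold compat. rewrite Eu, anc_id; auto. lia.
      * exists q', a, (inr (fun v => a v /\ S k < lev v /\ anc (lev q') v = q')).
        split; auto. split; [|split; [auto|intro; lia]].
        apply (legal_claim q); auto. split; [|split; [|split]].
        { repeat split; auto; [lia|]. now apply anc_id. }
        { intros v (Av & Lv & Ev). split; auto. intro. apply N. now exists v. }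
        { intros v w (Av & Lv & Ev) _ Hw Aw. pose proof (proj1 Hw). repeat split; auto; [lia|].
          rewrite (anc_child _ v w) by (auto; lia). exact Ev. }
        { intros v (Av & Lv & Ev) Pv. destruct (extendible _ v) as [w Hw].
          exists w. split; auto. pose proof (proj1 Hw). repeat split; [|lia|].
          - now apply (A2 v).
          - rewrite (anc_child _ v w) by (auto; lia). exact Ev. }
    + assert (L' : S k < lev q) by lia. specialize (L4 L').
      assert (H : exists r, child q r /\ match c with inl u => compat r u | inr b => b r end).
      { destruct c as [u|b].
        - destruct L4 as (K & _ & _ & Lu).
          destruct (Nat.le_gt_cases (lev u) (lev q)).
          + exists q'. split; auto. now apply (compat_above q).
          + exists (anc (S (lev q)) u). split.
            * rewrite <- (compat_below q u) at 1 by (auto; lia). apply anc_step. lia.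
            * unfold compat. rewrite lev_anc. rewrite (anc_id (lev u)) by (rewrite lev_anc; lia).
              f_equal. lia.
        - destruct L4 as (K & B1 & B2 & B3). specialize (K (lev q)). rewrite anc_id in K by lia.
          specialize (K ltac:(lia)).
          destruct (Nat.even (lev q)) eqn:Pq; [|now apply B3].
          destruct (L3 ltac:(lia)) as (_ & _ & A3). destruct (A3 q) as (r & Hr & Ar); auto.
          { now apply B1. }
          exists r. split; auto. now apply (B2 q). }
      destruct H as (r & Hr & M). exists r, a, c. split; auto. split; [|auto].
      now apply (legal_next q).
Qed.

Definition pos_tree : Tree.
Proof.
  refine {| node := pos; lev := fun p => lev (at_node p); par := pos_par; root := pos_root |}.
  - apply lev_root.
  - intros [q a c HL] L; simpl in L. pose proof HL as (L1 & L2 & _).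
    apply pos_ext; simpl; [now apply lev_zero|apply L1; lia|apply L2; lia].
  - intro p. simpl. apply lev_par.
  - intros [q a c HL]. destruct (legal_extend q a c HL) as (q' & a' & c' & Hc & HL' & Ea & Ec).
    exists (Build_pos q' a' c' HL'). simpl. split; [apply Hc|].
    destruct Hc as [E1 E2]. apply pos_ext; simpl; auto; rewrite E2.
    + destruct (Nat.le_gt_cases (lev q) k) as [L|L].
      * rewrite cut_low by auto. symmetry. now apply HL.
      * rewrite cut_high by auto. auto.
    + destruct (Nat.le_gt_cases (lev q) (S k)) as [L|L].
      * rewrite cut_low by auto. symmetry. now apply HL.
      * rewrite cut_high by auto. auto.
Defined.

Lemma pos_child (p r : pos) : child (G := pos_tree) p r <->
  child (at_node p) (at_node r) /\ (k < lev (at_node p) -> qI r = qI p) /\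
  (S k < lev (at_node p) -> claim r = claim p).
Proof.
  split.
  - intros [L E]. simpl in L, E. subst p. simpl in *. split; [now split|].
    split; intro; now rewrite cut_high.
  - intros ([L E] & Ea & Ec). split; [exact L|]. simpl.
    pose proof (legal_pos p) as (L1 & L2 & _).
    apply pos_ext; simpl; auto; rewrite E.
    + destruct (Nat.le_gt_cases (lev (at_node p)) k).
      * rewrite cut_low by auto. symmetry; auto.
      * rewrite cut_high; auto.
    + destruct (Nat.le_gt_cases (lev (at_node p)) (S k)).
      * rewrite cut_low by auto. symmetry; auto.
      * rewrite cut_high; auto.
Qed.

(* The response of [s] at [(q, a, c)]; the root is a junk value for illegal triples. *)
Definition ask (s : pos -> pos) q a c : pos :=
  match excluded_middle_informative (legal q a c) with
  | left HL => s (Build_pos q a c HL)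
  | right _ => pos_root
  end.

Lemma ask_eq s q a c (H : legal q a c) : ask s q a c = s (Build_pos q a c H).
Proof.
  unfold ask. destruct excluded_middle_informative; [|tauto].
  f_equal. now apply pos_ext.
Qed.

Lemma ask_local i n s t q a c : agree_upto (G := pos_tree) i n s t ->
  Nat.even (lev q) = i -> lev q <= n -> ask s q a c = ask t q a c.
Proof.
  intros A Ei L. unfold ask. destruct excluded_middle_informative; auto.
Qed.

(** * Lifting a run together with fixed announcements *)

Section Lift.
Context (x : nat -> G) (R : run x) (a : G -> Prop) (c : G + (G -> Prop)).

Definition seq_qI n := cut n k free a.
Definition seq_claim n := cut n (S k) no_claim c.
Context (HL : forall n, legal (x n) (seq_qI n) (seq_claim n)).

Definition lift n : pos := Build_pos (x n) _ _ (HL n).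

Lemma lift_run : run (G := pos_tree) lift.
Proof.
  split.
  - apply pos_ext; simpl; [apply R| |]; reflexivity.
  - intro n. apply pos_child. simpl. rewrite (run_lev x R). split; [apply R|].
    unfold seq_qI, seq_claim. split; intro; rewrite !cut_high by lia; reflexivity.
Qed.

(** Legality fixes the announcements before they are made and children inherit them afterwards, so
    only the nodes and the two announcing moves have to be compared. *)
Lemma lift_follows i s : strat (G := pos_tree) s ->
  (forall n, Nat.even n = i -> at_node (s (lift n)) = x (S n)) ->
  (Nat.even k = i -> qI (s (lift k)) = a) ->
  (Nat.even (S k) = i -> claim (s (lift (S k))) = c) ->
  follows (G := pos_tree) i s lift.
Proof.
  intros Hs Hn Ha Hc n En. simpl in n.
  destruct (proj1 (pos_child _ _) (Hs (lift n))) as (_ & Ea & Ec).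
  simpl in Ea, Ec. rewrite (run_lev x R) in Ea, Ec.
  pose proof (legal_pos (s (lift n))) as (L1 & L2 & _). rewrite Hn, (run_lev x R) in L1, L2 by auto.
  apply pos_ext; simpl; [now rewrite Hn| |].
  - unfold seq_qI in *. destruct (lt_eq_lt_dec n k) as [[L|L]|L].
    + rewrite cut_low, L1; auto.
    + subst n. rewrite cut_high, Ha; auto.
    + rewrite Ea, !cut_high by lia. auto.
  - unfold seq_claim in *. destruct (lt_eq_lt_dec n (S k)) as [[L|L]|L].
    + rewrite cut_low, L2; auto.
    + subst n. rewrite cut_high, Hc; auto.
    + rewrite Ec, !cut_high by lia. auto.
Qed.

End Lift.

Definition claim_ok (a : G -> Prop) (c : G + (G -> Prop)) :=
  match c with inl u => a u /\ O u /\ S k < lev u | inr b => qstratII a b end.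

Definition claim_at (c : G + (G -> Prop)) (q : G) :=
  match c with inl u => compat q u | inr b => b q end.

Lemma legal_run_high x a c n : run x -> legal (x (S k)) a no_claim -> claim_ok a c ->
  S k < n -> (forall l, S k < l <= n -> claim_at c (x l)) -> legal (x n) a c.
Proof.
  intros R H1 Hc L. induction L as [|n L IH]; intro Hl.
  - apply (legal_claim (x (S k))); [auto|now apply run_lev|apply R|].
    specialize (Hl (S (S k)) ltac:(lia)). destruct c; simpl in *; tauto.
  - apply (legal_next (x n)).
    + apply IH. intros l ?; apply Hl. lia.
    + rewrite (run_lev x R). lia.
    + apply R.
    + apply (Hl (S n)). lia.
Qed.

Lemma legal_run x a c : run x -> legal (x (S k)) a no_claim -> claim_ok a c ->
  (forall l, S k < l -> claim_at c (x l)) ->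
  forall n, legal (x n) (seq_qI a n) (seq_claim c n).
Proof.
  intros R H1 Hc Hl n. unfold seq_qI, seq_claim.
  destruct (lt_eq_lt_dec n (S k)) as [[L|L]|L].
  - rewrite !cut_low by lia. apply legal_low. rewrite (run_lev x R). lia.
  - subst n. rewrite cut_high, cut_low by lia. exact H1.
  - rewrite !cut_high by lia. apply legal_run_high; auto. intros l ?; apply Hl. lia.
Qed.

Lemma compat_run x n m : run x -> compat (x n) (x m).
Proof.
  intro R. unfold compat. rewrite !(run_lev x R).
  destruct (Nat.le_gt_cases n m).
  - rewrite run_anc by auto. symmetry. apply anc_id. rewrite (run_lev x R). lia.
  - rewrite (run_anc x m n) by (auto; lia). apply anc_id. rewrite (run_lev x R). lia.
Qed.

Lemma compat_eq x q m : run x -> compat q (x m) -> lev q <= m -> q = x (lev q).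
Proof.
  intros R E L. rewrite <- (compat_below q (x m)) at 1; auto.
  - now apply run_anc.
  - now rewrite (run_lev x R).
Qed.

(** * Strategies transferred from the tree with announcements *)

Definition first_hit (P : G -> Prop) (lo : nat) (v : G) :=
  least (fun l => lo <= l <= lev v /\ P (anc l v)).

Definition has_hit (P : G -> Prop) (lo : nat) (v : G) :=
  exists l, lo <= l <= lev v /\ P (anc l v).

Lemma first_hit_run P lo x L n : run x -> is_least (fun l => lo <= l /\ P (x l)) L ->
  L <= n -> has_hit P lo (x n) /\ first_hit P lo (x n) = L.
Proof.
  intros R [[H1 H2] H3] Ln. split.
  - exists L. rewrite (run_lev x R), run_anc; auto.
  - apply least_eq. rewrite (run_lev x R). split.
    + rewrite run_anc; auto.
    + intros m [Hm Pm]. rewrite run_anc in Pm by (auto; lia). apply H3. tauto.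
Qed.

Lemma no_hit_run P lo x n : run x -> (forall l, lo <= l <= n -> ~ P (x l)) ->
  ~ has_hit P lo (x n).
Proof.
  intros R H [l [Hl Pl]]. rewrite (run_lev x R) in Hl. rewrite run_anc in Pl by (auto; lia).
  now apply (H l).
Qed.

Definition choose {A} (P : Prop) (x y : A) : A :=
  if excluded_middle_informative P then x else y.

Lemma choose_l {A} (P : Prop) (x y : A) : P -> choose P x y = x.
Proof. unfold choose. destruct excluded_middle_informative; tauto. Qed.

Lemma choose_r {A} (P : Prop) (x y : A) : ~ P -> choose P x y = y.
Proof. unfold choose. destruct excluded_middle_informative; tauto. Qed.

Definition trI (s : pos -> pos) (v : G) : G := force_child v (
  if Nat.even (lev v) then
    if le_dec (lev v) k then at_node (ask s v free no_claim)
    else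
      let a := qI (ask s (anc k v) free no_claim) in
      choose (has_hit O (S (S k)) v)
        (at_node (ask s v a (inl (anc (first_hit O (S (S k)) v) v))))
      (choose (has_hit (Win true a O) (S (S k)) v)
        (win_strat true a O (anc (first_hit (Win true a O) (S (S k)) v) v) v)
        (at_node (ask s v a (inr (fun u => a u /\ ~ Win true a O u)))))
  else v).

Definition targets (f : (G -> Prop) -> pos) q u :=
  exists a, legal q a no_claim /\ claim (f a) = inl u.

Definition target_wit (f : (G -> Prop) -> pos) q u :=
  epsilon (inhabits free) (fun a => legal q a no_claim /\ claim (f a) = inl u).

(** Here the announcement of I is guessed. As long as II cannot force a node that [s] would claim
    against some [a], the guess is the set of all such positions; it contains no node of this kind,
    so [s] can only answer it with a quasi-strategy. Otherwise II forces such a node, and the guess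
    becomes an announcement against which [s] claims it. The reachability game is unrestricted
    because legality asks only the claimed node to lie in [a]. *)
Definition trII (s : pos -> pos) (v : G) : G := force_child v (
  if Nat.even (lev v) then v
  else if le_dec (lev v) k then at_node (ask s v free no_claim)
  else
    let q := anc (S k) v in
    let f := fun a => ask s q a no_claim in
    let U := targets f q in
    let W := Win false free U in
    choose (has_hit U 0 v)
      (let u := anc (first_hit U 0 v) v in at_node (ask s v (target_wit f q u) (inl u)))
    (choose (has_hit W (S k) v)
      (win_strat false free U (anc (first_hit W (S k) v) v) v)
      (let a := fun u => ~ W u in
       at_node (ask s v a (cut (lev v) (S k) no_claim (claim (f a))))))).

(** A move of I inside [a] into the winning region, or the lack of an escape for II, would put the
    position itself into that region. *)
Lemma safe_qstratII q a : qstratI q a -> qstratII a (fun u => a u /\ ~ Win true a O u).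
Proof.
  intros (A1 & A2 & A3). split; [|split].
  - intros v [Av N]. split; auto. intro. apply N. now apply Win_goal.
  - intros v w [Av N] Ev Hc Aw. split; auto. intro. apply N. now apply (Win_own _ _ _ v w).
  - intros v [Av N] Ev. destruct (not_Win_opp true a O v N) as (w & ? & ? & ?); [congruence|].
    exists w; auto.
Qed.

Lemma safe_qstratI q U : ~ Win false free U q -> qstratI q (fun u => ~ Win false free U u).
Proof.
  intro N. split; [exact N|split].
  - intros v w Nv Ev Hc W. apply Nv. apply (Win_own _ _ _ v w); auto. exact I.
  - intros v Nv Ev. destruct (not_Win_opp false free U v Nv) as (w & ? & ? & ?); [congruence|].
    exists w; auto.
Qed.

Lemma trI_lift s x : strat (G := pos_tree) s -> run x -> follows true (trI s) x ->
  exists y, run (G := pos_tree) y /\ follows (G := pos_tree) true s y /\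
    forall n, at_node (y n) = x n.
Proof.
  intros Hs R F. pose proof (run_lev x R) as Lx.
  assert (HLk : legal (x k) free no_claim) by (apply legal_low; rewrite Lx; lia).
  set (z := s (Build_pos (x k) free no_claim HLk)).
  set (a := qI z). set (W := Win true a O). set (b := fun u => a u /\ ~ W u).
  assert (Eask : forall n, k <= n -> ask s (anc k (x n)) free no_claim = z).
  { intros n Ln. rewrite run_anc by auto. apply ask_eq. }
  assert (Low : forall n (H : legal (x n) free no_claim), Nat.even n = true -> n <= k ->
    x (S n) = at_node (s (Build_pos (x n) free no_claim H))).
  { intros n H En Ln. rewrite F by auto. unfold trI. rewrite Lx, En.
    destruct le_dec; [|lia].
    rewrite (ask_eq s _ _ _ H).
    apply force_child_eq. destruct (proj1 (pos_child _ _) (Hs (Build_pos (x n) _ _ H))) as [Hc _].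
    exact Hc. }
  assert (Ez : at_node z = x (S k)) by (symmetry; now apply Low).
  assert (Qa : qstratI (x (S k)) a).
  { destruct (legal_pos z) as (_ & _ & L3 & _). rewrite Ez in L3.
    rewrite anc_id in L3 by (rewrite Lx; lia). apply L3. rewrite Lx; lia. }
  assert (H1 : legal (x (S k)) a no_claim) by (apply legal_start; auto).
  assert (Qb : qstratII a b) by (now apply (safe_qstratII (x (S k)))).
  assert (High : forall n, S k < n -> Nat.even n = true -> x (S n) = force_child (x n)
     (choose (has_hit O (S (S k)) (x n))
        (at_node (ask s (x n) a (inl (anc (first_hit O (S (S k)) (x n)) (x n)))))
      (choose (has_hit W (S (S k)) (x n))
        (win_strat true a O (anc (first_hit W (S (S k)) (x n)) (x n)) (x n))
        (at_node (ask s (x n) a (inr b)))))).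
  { intros n Ln En. rewrite F at 1 by auto. unfold trI. rewrite Lx, En.
    destruct le_dec; [lia|]. rewrite Eask by lia. reflexivity. }
  assert (Asks : forall n c (H : legal (x n) a c), S k < n ->
    force_child (x n) (at_node (ask s (x n) a c)) = at_node (s (Build_pos _ _ _ H)) /\
    legal (at_node (s (Build_pos _ _ _ H))) a c).
  { intros n c H Ln. rewrite (ask_eq s _ _ _ H).
    destruct (proj1 (pos_child _ _) (Hs (Build_pos (x n) _ _ H))) as (Hc & Ea & Ec).
    simpl in Hc, Ea, Ec. rewrite Lx in Ea, Ec.
    split; [now apply force_child_eq|].
    pose proof (legal_pos (s (Build_pos _ _ _ H))) as HL. rewrite Ea, Ec in HL by lia. exact HL. }
  assert (Calm : forall n, (forall l, S k < l <= n -> ~ W (x l)) -> ~ has_hit O (S (S k)) (x n)).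
  { intros n H. apply no_hit_run; auto. intros l Hl Ol. apply (H l); [lia|]. now apply Win_goal. }
  (* The moves of I come from [s] under the announcement [b], and those of II cannot leave a
     quasi-strategy of I. The last node is allowed to be in [W], so that the first node of [W] on
     the run is covered. *)
  assert (Stay : forall n, (forall l, S k < l < n -> ~ W (x l)) ->
    forall l, S k <= l <= n -> a (x l)).
  { induction n as [|n IH]; intros N l Hl; [lia|].
    assert (An : forall l, S k <= l <= n -> a (x l)) by (apply IH; intros; apply N; lia).
    destruct (Nat.eq_dec l (S n)) as [->|]; [|apply An; lia].
    destruct (Nat.eq_dec n k) as [->|]; [apply Qa|].
    destruct (Nat.even n) eqn:En.
    2:{ apply (proj1 (proj2 Qa) (x n)); auto; [apply An; lia|now rewrite Lx|apply R]. }
    assert (Ln' : S k < n).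
    { destruct (Nat.eq_dec n (S k)) as [->|]; [|lia]. rewrite odd_Sk in En. discriminate. }
    assert (Hb : legal (x n) a (inr b)).
    { apply legal_run_high; auto. intros m Hm. split; [apply An; lia|apply N; lia]. }
    rewrite High by auto. rewrite choose_r by (apply Calm; intros m Hm; apply N; lia).
    rewrite choose_r by (apply no_hit_run; auto; intros m Hm; apply N; lia).
    destruct (Asks n (inr b) Hb Ln') as [-> (_ & _ & _ & L4)].
    destruct (proj1 (pos_child _ _) (Hs (Build_pos _ _ _ Hb))) as [[Lc _] _].
    simpl in Lc. rewrite Lx in Lc.
    destruct L4 as [K _]; [lia|]. specialize (K (S n)). rewrite anc_id in K by lia.
    apply K. lia. }
  destruct (classic (exists n, S (S k) <= n /\ W (x n))) as [HW|HW].
  - destruct (exists_least _ HW) as [L HL].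
    pose proof HL as [[LL WL] Lmin].
    assert (NW : forall l, S k < l < L -> ~ W (x l)).
    { intros l Hl Wl. assert (L <= l) by (apply Lmin; split; auto; lia). lia. }
    assert (aL : a (x L)) by (apply (Stay L NW); lia).
    assert (Opp : forall v w, a v -> Nat.even (lev v) <> true -> child v w -> a w).
    { intros v w Av Ev. apply (proj1 (proj2 Qa)); auto. now destruct (Nat.even (lev v)). }
    destruct (win_strat_spec true a O Opp (x L) WL aL) as [_ HW'].
    destruct (HW' x R) as (m & Lm & Om & Dm); rewrite ?Lx in *; auto.
    { intros m Lm Nm Em. rewrite High by (auto; lia).
      destruct (first_hit_run W (S (S k)) x L m R HL Lm) as [Hh Eh].
      rewrite choose_r.
      - rewrite choose_l, Eh, run_anc by auto. apply force_child_eq.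
        apply (win_strat_spec true a O Opp (x L) WL aL).
      - apply no_hit_run; auto. intros l Hl Ol. apply (Nm l); auto. split; [|lia].
        apply Lmin. split; [lia|]. now apply Win_goal. }
    (* The first node in [O] is reached while the run is still inside [a], so II may legally have
       claimed it. *)
    destruct (exists_least (fun l => S (S k) <= l /\ O (x l))) as [M HM].
    { exists m. split; auto. lia. }
    pose proof HM as [[LM OM] Mmin].
    assert (LLM : L <= M) by (apply Lmin; split; auto; now apply Win_goal).
    assert (HLg : forall n, legal (x n) (seq_qI a n) (seq_claim (inl (x M)) n)).
    { apply legal_run; auto.
      - simpl. rewrite Lx. repeat split; auto. apply Dm. split; auto. apply Mmin. split; auto. lia.
      - intros l _. now apply compat_run. }
    exists (lift x a _ HLg). split; [now apply lift_run|]. split; [|reflexivity].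
    apply lift_follows; auto.
    + intros n En. destruct (Nat.le_gt_cases n k) as [Ln|Ln].
      { unfold lift. generalize (HLg n). unfold seq_qI, seq_claim. rewrite !cut_low by lia.
        intro H. symmetry. now apply Low. }
      assert (Ln' : S k < n).
      { destruct (Nat.eq_dec n (S k)) as [->|]; [|lia]. rewrite odd_Sk in En. discriminate. }
      unfold lift. generalize (HLg n). unfold seq_qI, seq_claim. rewrite !cut_high by lia.
      intro H. destruct (Asks n _ H Ln') as [E HL'].
      destruct (Nat.le_gt_cases M n) as [LMn|LMn].
      * rewrite (High n) by auto.
        destruct (first_hit_run O (S (S k)) x M n R HM LMn) as [Hh Eh].
        rewrite choose_l, Eh, run_anc by auto. now rewrite E.
      (* Before the claimed node legality leaves a single child. The answer of [s] under the claim
         therefore agrees with the run, whichever rule of [trI] produced the move. *)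
      * destruct (proj1 (pos_child _ _) (Hs (Build_pos _ _ _ H))) as [[Lc _] _].
        simpl in Lc. rewrite Lx in Lc.
        destruct HL' as (_ & _ & _ & L4). destruct L4 as [K _]; [lia|].
        rewrite (compat_eq x _ M R K) by lia. now rewrite Lc.
    + intros _. unfold lift. generalize (HLg k). unfold seq_qI, seq_claim. rewrite !cut_low by lia.
      intro H. unfold a, z. do 2 f_equal. now apply pos_ext.
    + rewrite odd_Sk. discriminate.
  - assert (NW : forall l, S k < l -> ~ W (x l)) by (intros l Hl Wl; apply HW; eauto).
    assert (Hb : forall l, S k < l -> b (x l)).
    { intros l Hl. split; [|now apply NW]. apply (Stay l); [|lia]. intros; apply NW; lia. }
    assert (HLg : forall n, legal (x n) (seq_qI a n) (seq_claim (inr b) n)).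
    { apply legal_run; auto. }
    exists (lift x a _ HLg). split; [now apply lift_run|]. split; [|reflexivity].
    apply lift_follows; auto.
    + intros n En. destruct (Nat.le_gt_cases n k) as [Ln|Ln].
      { unfold lift. generalize (HLg n). unfold seq_qI, seq_claim. rewrite !cut_low by lia.
        intro H. symmetry. now apply Low. }
      assert (Ln' : S k < n).
      { destruct (Nat.eq_dec n (S k)) as [->|]; [|lia]. rewrite odd_Sk in En. discriminate. }
      unfold lift. generalize (HLg n). unfold seq_qI, seq_claim. rewrite !cut_high by lia.
      intro H. destruct (Asks n _ H Ln') as [E _].
      rewrite (High n) by auto.
      rewrite choose_r by (apply Calm; intros l Hl; apply NW; lia).
      rewrite choose_r by (apply no_hit_run; auto; intros l Hl; apply NW; lia).
      now rewrite E.
    + intros _. unfold lift. generalize (HLg k). unfold seq_qI, seq_claim. rewrite !cut_low by lia.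
      intro H. unfold a, z. do 2 f_equal. now apply pos_ext.
    + rewrite odd_Sk. discriminate.
Qed.

Lemma trII_lift s x : strat (G := pos_tree) s -> run x -> follows false (trII s) x ->
  exists y, run (G := pos_tree) y /\ follows (G := pos_tree) false s y /\
    forall n, at_node (y n) = x n.
Proof.
  intros Hs R F. pose proof (run_lev x R) as Lx.
  set (q := x (S k)). assert (Lq : lev q = S k) by apply Lx.
  set (f := fun a => ask s q a no_claim). set (U := targets f q).
  set (W := Win false free U).
  assert (Low : forall n (H : legal (x n) free no_claim), Nat.even n = false -> n <= k ->
    x (S n) = at_node (s (Build_pos (x n) free no_claim H))).
  { intros n H En Ln. rewrite F by auto. unfold trII. rewrite Lx, En.
    destruct le_dec; [|lia]. rewrite (ask_eq s _ _ _ H).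
    apply force_child_eq. destruct (proj1 (pos_child _ _) (Hs (Build_pos (x n) _ _ H))) as [Hc _].
    exact Hc. }
  assert (High : forall n, S k <= n -> Nat.even n = false -> x (S n) = force_child (x n)
    (choose (has_hit U 0 (x n))
      (let u := anc (first_hit U 0 (x n)) (x n) in at_node (ask s (x n) (target_wit f q u) (inl u)))
    (choose (has_hit W (S k) (x n))
      (win_strat false free U (anc (first_hit W (S k) (x n)) (x n)) (x n))
      (at_node (ask s (x n) (fun u => ~ W u)
         (cut n (S k) no_claim (claim (f (fun u => ~ W u))))))))).
  { intros n Ln En. rewrite F at 1 by auto. unfold trII. rewrite Lx, En.
    destruct le_dec; [lia|]. rewrite run_anc by auto. reflexivity. }
  assert (Asks : forall n a c (H : legal (x n) a c), k < n ->
    force_child (x n) (at_node (ask s (x n) a c)) = at_node (s (Build_pos _ _ _ H)) /\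
    child (x n) (at_node (s (Build_pos _ _ _ H))) /\
    legal (at_node (s (Build_pos _ _ _ H))) a (cut n (S k) (claim (s (Build_pos _ _ _ H))) c)).
  { intros n a c H Ln. rewrite (ask_eq s _ _ _ H).
    destruct (proj1 (pos_child _ _) (Hs (Build_pos (x n) _ _ H))) as (Hc & Ea & Ec).
    simpl in Hc, Ea, Ec. rewrite Lx in Ea, Ec.
    split; [now apply force_child_eq|split; auto].
    pose proof (legal_pos (s (Build_pos _ _ _ H))) as HL. rewrite Ea in HL by lia.
    destruct (Nat.le_gt_cases n (S k)).
    - now rewrite cut_low.
    - rewrite cut_high by auto. rewrite Ec in HL by auto. exact HL. }
  assert (HU : forall u, U u -> S k < lev u).
  { intros u (a & H & Ec). unfold f in Ec. rewrite (ask_eq s _ _ _ H) in Ec.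
    destruct (Asks (S k) a no_claim H) as (_ & [Lc _] & (_ & _ & _ & L4)); [lia|].
    fold q in Lc, L4. rewrite cut_low, Ec in L4 by auto. apply L4. lia. }
  assert (Below : forall a c (HLg : forall n, legal (x n) (seq_qI a n) (seq_claim c n)) n,
    n <= k -> Nat.even n = false -> at_node (s (lift x a c HLg n)) = x (S n)).
  { intros a c HLg n Ln En. unfold lift. generalize (HLg n). unfold seq_qI, seq_claim.
    rewrite !cut_low by lia. intro H. symmetry. now apply Low. }
  assert (At : forall a c (HLg : forall n, legal (x n) (seq_qI a n) (seq_claim c n)) (H : legal q a no_claim),
    lift x a c HLg (S k) = Build_pos q a no_claim H).
  { intros a c HLg H. apply pos_ext; simpl; unfold seq_qI, seq_claim; auto.
    - now rewrite cut_high by lia.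
    - now rewrite cut_low by lia. }
  destruct (classic (exists n, 0 <= n /\ U (x n))) as [HH|HH].
  - destruct (exists_least _ HH) as [L HL]. pose proof HL as [[_ UL] _].
    set (a := target_wit f q (x L)).
    assert (Ha : legal q a no_claim /\ claim (f a) = inl (x L)).
    { unfold a, target_wit. apply epsilon_spec, UL. }
    destruct Ha as [Ha Ea]. unfold f in Ea. rewrite (ask_eq s _ _ _ Ha) in Ea.
    destruct (Asks (S k) a no_claim Ha) as (_ & [Lc _] & (_ & _ & _ & L4)); [lia|].
    fold q in Lc, L4. rewrite cut_low, Ea in L4 by auto. destruct L4 as (K & aL & OL & LL); [lia|].
    rewrite Lx in LL.
    assert (HLg : forall n, legal (x n) (seq_qI a n) (seq_claim (inl (x L)) n)).
    { apply legal_run; auto.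
      - simpl. rewrite Lx. auto.
      - intros l _. now apply compat_run. }
    exists (lift x a _ HLg). split; [now apply lift_run|]. split; [|reflexivity].
    apply lift_follows; auto.
    + intros n En. destruct (Nat.le_gt_cases n k) as [Ln|Ln]; [now apply Below|].
      destruct (Nat.eq_dec n (S k)) as [->|Nn].
      (* The move made together with the claim must already lead towards the claimed node [x L],
         hence is the move of the run. *)
      { rewrite (At _ _ _ Ha). rewrite (compat_eq x _ L R K) by lia. rewrite Lc, Lq. reflexivity. }
      unfold lift. generalize (HLg n). unfold seq_qI, seq_claim. rewrite !cut_high by lia.
      intro H. destruct (Asks n a _ H) as (E & [Ln' _] & HL'); [lia|].
      rewrite cut_high in HL' by lia.
      destruct (Nat.le_gt_cases L n) as [LMn|LMn].
      * rewrite (High n) by (auto; lia).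
        destruct (first_hit_run U 0 x L n R HL LMn) as [Hh Eh].
        rewrite choose_l by auto. cbv zeta. rewrite Eh, run_anc by auto. symmetry. exact E.
      * rewrite Lx in Ln'. destruct HL' as (_ & _ & _ & L4). destruct L4 as [K' _]; [lia|].
        rewrite (compat_eq x _ L R K') by lia. now rewrite Ln'.
    + rewrite k_even. discriminate.
    + intros _. now rewrite (At _ _ _ Ha).
  - assert (NU : forall n, ~ U (x n)) by (intros n Hn; apply HH; exists n; split; auto; lia).
    assert (NH : forall n, ~ has_hit U 0 (x n)) by (intro n; apply no_hit_run; auto).
    assert (NW : forall n, S k <= n -> ~ W (x n)).
    { intros n Ln Wn.
      destruct (exists_least (fun n => S k <= n /\ W (x n))) as [L HL]; [eauto|].
      pose proof HL as [[LL WL] Lmin].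
      destruct (win_strat_spec false free U (fun _ _ _ _ _ => I) (x L) WL I) as [Hst HW'].
      destruct (HW' x R) as (m & _ & Um & _); rewrite ?Lx in *; auto; [|now apply (NU m)].
      intros m Lm Nm Em. rewrite High by (auto; lia).
      destruct (first_hit_run W (S k) x L m R HL Lm) as [Hh Eh].
      rewrite choose_r by auto. rewrite choose_l, Eh, run_anc by auto.
      apply force_child_eq, Hst. }
    set (a := fun u => ~ W u).
    assert (Qa : qstratI q a) by (apply safe_qstratI, (NW (S k)); auto).
    assert (Ha : legal q a no_claim) by (now apply legal_start).
    set (z := s (Build_pos q a no_claim Ha)).
    destruct (Asks (S k) a no_claim Ha) as (Ez & [Lc _] & (_ & _ & _ & L4)); [lia|].
    fold q z in Ez, Lc, L4. rewrite cut_low in L4 by auto. specialize (L4 ltac:(lia)).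
    assert (Hz : f a = z) by apply ask_eq.
    destruct (claim z) as [u|b] eqn:Ecl.
    (* A node claimed against [a] would be a target, thus in [W], whereas [a] is the complement of
       [W]. *)
    { exfalso. destruct L4 as (_ & au & _). apply au, Win_goal.
      exists a. rewrite Hz. auto. }
    destruct L4 as [K Qb].
    assert (E1 : x (S (S k)) = at_node z).
    { rewrite High by (auto using odd_Sk). rewrite choose_r by auto.
      rewrite choose_r by (apply no_hit_run; auto; intros; apply NW; lia).
      rewrite cut_low by auto. exact Ez. }
    assert (Hb : forall n, S k < n -> forall l, S k < l <= n -> b (x l)).
    { intros n Ln. induction Ln as [|n Ln IH]; intros l Hl.
      - replace l with (lev (at_node z)) by lia. rewrite Lc, Lq, E1.
        specialize (K (S (S k))). rewrite anc_id in K by lia. apply K. lia.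
      - destruct (Nat.eq_dec l (S n)) as [->|]; [|apply IH; lia].
        assert (bn : b (x n)) by (apply IH; lia).
        destruct (Nat.even n) eqn:En.
        { apply (proj1 (proj2 Qb) (x n)); auto; [now rewrite Lx|apply R|apply NW; lia]. }
        assert (H : legal (x n) a (inr b)) by (apply legal_run_high; auto).
        rewrite High by (auto; lia). rewrite choose_r by auto.
        rewrite choose_r by (apply no_hit_run; auto; intros; apply NW; lia).
        rewrite cut_high by lia. fold a. rewrite Hz, Ecl.
        destruct (Asks n a _ H) as (-> & [Ln' _] & HL'); [lia|].
        rewrite cut_high in HL' by lia. rewrite Lx in Ln'.
        destruct HL' as (_ & _ & _ & L4). destruct L4 as [K' _]; [lia|].
        specialize (K' (S n)). rewrite anc_id in K' by lia. apply K'. lia. }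
    assert (HLg : forall n, legal (x n) (seq_qI a n) (seq_claim (inr b) n)).
    { apply legal_run; auto. intros l Hl. apply (Hb l); auto. }
    exists (lift x a _ HLg). split; [now apply lift_run|]. split; [|reflexivity].
    apply lift_follows; auto.
    + intros n En. destruct (Nat.le_gt_cases n k) as [Ln|Ln]; [now apply Below|].
      destruct (Nat.eq_dec n (S k)) as [->|Nn].
      { rewrite (At _ _ _ Ha). now rewrite E1. }
      unfold lift. generalize (HLg n). unfold seq_qI, seq_claim. rewrite !cut_high by lia.
      intro H. destruct (Asks n a _ H) as (E & _); [lia|].
      rewrite (High n) by (auto; lia). rewrite choose_r by auto.
      rewrite choose_r by (apply no_hit_run; auto; intros; apply NW; lia).
      rewrite cut_high by lia. fold a. rewrite Hz, Ecl. symmetry. exact E.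
    + rewrite k_even. discriminate.
    + intros _. now rewrite (At _ _ _ Ha).
Qed.

Definition pos_tr (i : bool) := if i then trI else trII.

Lemma pos_tr_local i n s t : agree_upto (G := pos_tree) i n s t ->
  agree_upto i n (pos_tr i s) (pos_tr i t).
Proof.
  intros A v Ei Lv. destruct i; simpl.
  - unfold trI. rewrite Ei.
    assert (E : forall a c, ask s v a c = ask t v a c) by (intros; now apply (ask_local true n)).
    destruct le_dec as [L|L]; [now rewrite E|].
    assert (Ek : ask s (anc k v) free no_claim = ask t (anc k v) free no_claim).
    { apply (ask_local true n); auto; rewrite lev_anc; [|lia]. now rewrite Nat.min_l by lia. }
    now rewrite Ek, !E.
  - unfold trII. rewrite Ei.
    assert (E : forall a c, ask s v a c = ask t v a c) by (intros; now apply (ask_local false n)).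
    destruct le_dec as [L|L]; [now rewrite E|].
    assert (Ek : forall a, ask s (anc (S k) v) a no_claim = ask t (anc (S k) v) a no_claim).
    { intro a. apply (ask_local false n); auto; rewrite lev_anc; [|lia].
      rewrite Nat.min_l by lia. apply odd_Sk. }
    cbv zeta. now rewrite (functional_extensionality _ _ Ek), Ek, !E.
Qed.

Lemma pos_tr_below i s p : strat (G := pos_tree) s -> Nat.even (lev (at_node p)) = i ->
  lev (at_node p) < k -> pos_tr i s (at_node p) = at_node (s p).
Proof.
  intros Hs Ei L. destruct p as [v a c H]. simpl in *.
  assert (a = free) as -> by (apply H; lia). assert (c = no_claim) as -> by (apply H; lia).
  destruct i; simpl; [unfold trI|unfold trII]; rewrite Ei;
    (destruct le_dec; [|lia]); rewrite (ask_eq s _ _ _ H); apply force_child_eq;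
    destruct (proj1 (pos_child _ _) (Hs (Build_pos _ _ _ H))) as [Hc _]; exact Hc.
Qed.

Definition pos_cov : Cov k G pos_tree.
Proof.
  refine {| pi := at_node : pos_tree -> G; tr := pos_tr |}.
  - reflexivity.
  - reflexivity.
  - intros [q a c H] [q' a' c' H'] L E. simpl in *. subst q'.
    apply pos_ext; simpl; auto.
    + transitivity free; [apply H|symmetry; apply H']; auto.
    + transitivity no_claim; [apply H|symmetry; apply H']; auto.
  - intros v L. now exists (Build_pos v free no_claim (legal_low v L)).
  - intros [] s _ v; apply force_child_spec.
  - intros i n s t _ _. apply pos_tr_local.
  - intros i s p. apply pos_tr_below.
  - intros [] s x; [apply trI_lift|apply trII_lift].
Defined.

(** The open set has become clopen: a claimed node has to be passed, an announced quasi-strategy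
    avoids [O] for good, and closure of [O] under children moves an early hit beyond the
    announcement. *)
Lemma pos_decides y : run (G := pos_tree) y ->
  (exists n, O (at_node (y n))) <-> (exists u, claim (y (S (S k))) = inl u).
Proof.
  intro R. set (x := fun n => at_node (y n)).
  assert (Rx : run x) by apply (pi_run pos_cov y R).
  pose proof (run_lev x Rx) as Lx.
  assert (St : forall d, claim (y (d + S (S k))) = claim (y (S (S k)))).
  { induction d; auto. rewrite <- IHd. apply (pos_child (y (d + S (S k)))); [apply R|].
    fold (x (d + S (S k))). rewrite Lx. lia. }
  assert (St' : forall n, S k < n -> claim (y n) = claim (y (S (S k)))).
  { intros n L. rewrite <- (St (n - S (S k))). do 2 f_equal. lia. }
  assert (HL : forall n, S k < n -> match claim (y (S (S k))) with
    | inl u => compat (x n) u /\ O u /\ S k < lev u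
    | inr b => ~ O (x n) end).
  { intros n L. rewrite <- (St' n L). destruct (legal_pos (y n)) as (_ & _ & _ & L4).
    fold (x n) in L4. rewrite Lx in L4. specialize (L4 L).
    destruct (claim (y n)) as [u|b]; [tauto|]. destruct L4 as [K (B & _)].
    specialize (K n). rewrite anc_id in K by now rewrite Lx. apply B, K. lia. }
  split.
  - intros [n On]. destruct (claim (y (S (S k)))) as [u|b]; [now exists u|].
    exfalso. apply (HL (n + S (S k))); [lia|].
    fold (x n) in On. clear - On O_up Rx. induction (S (S k)) as [|m IH].
    + now rewrite Nat.add_0_r.
    + rewrite Nat.add_succ_r. apply (O_up (x (n + m))); auto. apply Rx.
  - intros [u Eu]. rewrite Eu in HL. exists (lev u).
    assert (Lu : S k < lev u) by (apply (HL (S (S k))); lia).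
    destruct (HL (lev u) Lu) as (K & Ou & _). fold (x (lev u)).
    apply compat_below in K; [|now rewrite Lx]. rewrite Lx, anc_id in K by auto.
    now rewrite <- K.
Qed.
End Unravel.

(** * Borel determinacy *)

(** [rd] reads one bit off each node, so that the same set of sequences makes sense on every tree of
    a tower. Its preimage is clopen in the strong sense that one fixed level decides it. *)
Record Unraveling (P : Cantor -> Prop) (k : nat) (G : Tree) (rd : G -> bool) := {
  top : Tree;
  cov : Cov k G top;
  horizon : nat;
  verdict : top -> Prop;
  verdict_spec : forall y, run y ->
    (P (fun i => rd (pi cov (y (S i)))) <-> verdict (y horizon)) }.

Arguments top {P k G rd}.
Arguments cov {P k G rd}.
Arguments horizon {P k G rd}.
Arguments verdict {P k G rd}.

Definition unravelable P := forall k G rd, inhabited (Unraveling P k G rd).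

Lemma unravelable_ext P Q : (forall A, P A <-> Q A) -> unravelable P -> unravelable Q.
Proof.
  intros E HP k G rd. destruct (HP k G rd) as [[H C N D Sp]].
  constructor. refine {| cov := C; horizon := N; verdict := D |}.
  intros y R. rewrite <- E. now apply Sp.
Qed.

Lemma unravelable_compl P : unravelable P -> unravelable (fun A => ~ P A).
Proof.
  intros HP k G rd. destruct (HP k G rd) as [[H C N D Sp]].
  constructor. refine {| cov := C; horizon := N; verdict := fun v => ~ D v |}.
  intros y R. now rewrite (Sp y R).
Qed.

Lemma unravelable_finite P n : (forall A B, agree A B n -> P A -> P B) -> unravelable P.
Proof.
  intros HP k G rd. constructor.
  refine {| cov := cov_id k G; horizon := n;
            verdict := fun v => P (fun i => rd (anc (S i) v)) |}.
  intros y R. simpl. split; apply HP; intros i Hi; now rewrite run_anc by (auto; lia).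
Qed.

Section Union.
Context (P : nat -> Cantor -> Prop) (HP : forall n, unravelable (P n))
  (k : nat) (G : Tree) (rd : G -> bool).

Definition unravel_step n (X : {G : Tree & G -> bool}) :
  Unraveling (P n) (k + n) (projT1 X) (projT2 X) :=
  epsilon (HP n (k + n) (projT1 X) (projT2 X)) (fun _ => True).

Fixpoint tower n : {G : Tree & G -> bool} :=
  match n with
  | 0 => existT (fun G : Tree => G -> bool) G rd
  | S n => existT (fun G : Tree => G -> bool) (top (unravel_step n (tower n)))
      (fun v => projT2 (tower n) (pi (cov (unravel_step n (tower n))) v))
  end.

Definition tower_cov n : Cov (k + n) (projT1 (tower n)) (projT1 (tower (S n))) :=
  cov (unravel_step n (tower n)).

Let L := limit_tree k (fun n => projT1 (tower n)) tower_cov.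

(** [P j] is decided in the tree [S j] at its horizon; demanding that [t] has reached this level
    makes acceptance persist at children, so the union is an open condition on the limit tree. *)
Definition accepted (t : L) := exists j,
  horizon (unravel_step j (tower j)) <= lev t /\
  verdict (unravel_step j (tower j)) (anc (horizon (unravel_step j (tower j))) (at_ t (S j))).

Lemma accepted_up t u : accepted t -> child t u -> accepted u.
Proof.
  intros (j & Hl & Hv) Hc. exists j. pose proof (proj1 Hc). split; [lia|].
  pose proof (proj2 (thread_child _ _ _ t u) Hc (S j)) as Hcj. simpl in Hcj.
  rewrite (anc_child _ _ _ Hcj); auto.
  etransitivity; [exact Hl|]. apply Nat.eq_le_incl. symmetry. exact (thread_lev _ _ _ t (S j)).
Qed.

Lemma tower_rd (t : L) j : projT2 (tower j) (at_ t j) = rd (at_ t 0).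
Proof.
  induction j; auto. rewrite <- IHj. simpl. f_equal. exact (thread_eq t j).
Qed.

Lemma accepted_spec (y : nat -> L) : run y ->
  (exists n, accepted (y n)) <-> (exists j, P j (fun i => rd (at_ (y (S i)) 0))).
Proof.
  intro R.
  assert (Rj : forall j, run (fun n => at_ (y n) j)).
  { intro j. split; [now rewrite (proj1 R)|].
    intro n. exact (proj2 (thread_child _ _ _ (y n) (y (S n))) (proj2 R n) j). }
  assert (Sp : forall j, P j (fun i => rd (at_ (y (S i)) 0)) <->
    verdict (unravel_step j (tower j)) (at_ (y (horizon (unravel_step j (tower j)))) (S j))).
  { intro j. rewrite <- (verdict_spec _ _ _ _ (unravel_step j (tower j)) _ (Rj (S j))).
    assert (E : (fun i => rd (at_ (y (S i)) 0)) = (fun i => projT2 (tower j)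
      (pi (cov (unravel_step j (tower j))) (at_ (y (S i)) (S j))))).
    { apply functional_extensionality. intro i. rewrite <- (tower_rd (y (S i)) j). f_equal.
      symmetry. exact (thread_eq (y (S i)) j). }
    now rewrite E. }
  split.
  - intros (n & j & Hl & Hv). exists j. apply Sp. rewrite (run_lev y R) in Hl.
    now rewrite (run_anc _ _ n (Rj (S j))) in Hv.
  - intros [j Hj]. exists (horizon (unravel_step j (tower j))), j.
    rewrite (run_lev y R). split; auto. apply Sp in Hj.
    rewrite anc_id; auto. apply Nat.eq_le_incl. apply (run_lev _ (Rj (S j))).
Qed.

Lemma unravel_union : inhabited (Unraveling (fun A => exists n, P n A) k G rd).
Proof.
  (* The covering for open sets needs an even level; [k + k] is an even bound of [k]. *)
  assert (Ev : Nat.even (k + k) = true).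
  { replace (k + k) with (2 * k) by lia. rewrite Nat.even_mul. reflexivity. }
  assert (Lk : k <= k + k) by lia.
  constructor.
  refine {| cov := cov_comp (limit_cov k (fun n => projT1 (tower n)) tower_cov)
                     (cov_weaken Lk (pos_cov (k + k) accepted Ev));
            horizon := S (S (k + k)); verdict := fun p => exists u, claim _ _ p = inl u |}.
  intros y R. simpl.
  refine (iff_trans _ (pos_decides (k + k) accepted Ev accepted_up y R)).
  apply iff_sym. apply (accepted_spec (fun n => at_node _ _ (y n))).
  apply (pi_run (pos_cov (k + k) accepted Ev) y R).
Qed.

End Union.

Lemma borel_unravelable P : borel_set P -> unravelable P.
Proof.
  induction 1.
  - apply (unravelable_finite _ (length s)). intros A B E HA i Hi. now rewrite <- E, HA.
  - now apply unravelable_compl.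
  - intros k G rd. now apply unravel_union.
  - eapply unravelable_ext; eauto.
Qed.

Theorem borel_determinacy (P : Cantor -> Prop) (G : Tree) (rd : G -> bool) : borel_set P ->
  (exists s, strat s /\ forall x, run x -> follows true s x -> P (fun i => rd (x (S i)))) \/
  (exists s, strat s /\ forall x, run x -> follows false s x -> ~ P (fun i => rd (x (S i)))).
Proof.
  intro HP. destruct (borel_unravelable P HP 0 G rd) as [[H C N D Sp]].
  (* Winning strategies of both players descend alike: [Q] is the identity for one and negation for
     the other. *)
  assert (Tr : forall i (Q : Prop -> Prop), (exists s, strat s /\
      forall y, run y -> follows i s y -> Q (D (y N))) ->
    exists s, strat s /\ forall x, run x -> follows i s x -> Q (P (fun i => rd (x (S i))))).
  { intros i Q (s & Hs & W). exists (tr C i s). split; [now apply tr_strat|].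
    intros x R F. destruct (tr_lift _ _ _ C i s x Hs R F) as (y & Ry & Fy & E).
    specialize (W y Ry Fy).
    assert (E' : (fun i => rd (x (S i))) = (fun i => rd (pi C (y (S i))))).
    { apply functional_extensionality. intro. now rewrite E. }
    rewrite E'. replace (P _) with (D (y N)); auto.
    apply propositional_extensionality. symmetry. now apply Sp. }
  (* In the unraveled game level [N] settles the outcome, so it is a reachability game. If the root
     is not won, the second player simply stays outside [W]. *)
  set (goal := fun v : H => lev v = N /\ D v).
  set (W := Win true (fun _ => True) goal).
  destruct (classic (W root)) as [HW|HW].
  - left. apply (Tr true (fun X => X)).
    destruct (Win_strategy true (fun _ => True) goal (fun _ _ _ _ _ => I) root HW I) as (s & Hs & Ws).
    exists s. split; auto. intros y R F. rewrite lev_root in Ws.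
    destruct (Ws y R (proj1 R)) as (m & _ & [Lm Dm] & _).
    { intros m _ _ Em. now apply F. }
    rewrite (run_lev y R) in Lm. now subst.
  - right. apply (Tr false (fun X => ~ X)).
    set (good := fun v w : H => child v w /\ ~ W w).
    exists (fun v => force_child v (epsilon (inhabits root) (good v))).
    split; [intro; apply force_child_spec|]. intros y R F.
    assert (NW : forall n, ~ W (y n)).
    { induction n as [|n IH]; [now rewrite (proj1 R)|].
      destruct (Nat.even n) eqn:En.
      - intro Wn. apply IH. apply (Win_own _ _ _ (y n) (y (S n))); auto.
        + now rewrite (run_lev y R).
        + apply R.
      - rewrite F by auto.
        assert (Hg : good (y n) (epsilon (inhabits root) (good (y n)))).
        { apply epsilon_spec.
          destruct (not_Win_opp true (fun _ => True) goal (y n) IH) as (w & ? & _ & ?).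
          - rewrite (run_lev y R). congruence.
          - now exists w. }
        rewrite force_child_eq; apply Hg. }
    intro Dn. apply (NW N). apply Win_goal. split; auto. now apply run_lev.
Qed.

(** * Borel sets and the Wadge game *)

Lemma borel_finite (P : Cantor -> Prop) n :
  (forall A B, agree A B n -> P A -> P B) -> borel_set P.
Proof.
  intro HP.
  assert (H : forall d (s : list bool), length s + d = n ->
    borel_set (fun A => P A /\ forall i, i < length s -> A i = List.nth i s false)).
  { induction d as [|d IH]; intros s Hs.
    - set (C := fun A : Cantor => forall i, i < length s -> A i = List.nth i s false).
      destruct (classic (exists A, P A /\ C A)) as [(A & PA & CA)|N].
      + apply (bs_ext C); [|apply bs_cyl]. intro B. split; [|tauto].
        intro CB. split; auto. apply (HP A); auto. intros i Hi.
        rewrite CA, CB; auto; lia.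
      + apply (bs_ext (fun A => ~ forall i, i < @length bool nil -> A i = List.nth i nil false)).
        * intro A. split; [|intro HA; exfalso; eauto]. intro H. destruct H. simpl. lia.
        * apply bs_compl, bs_cyl.
    (* Countable unions are indexed by numbers: [j = 0] appends [true], every other [j] appends
       [false]. *)
    - set (T := fun (j : nat) A => P A /\ forall i, i < length (s ++ [j =? 0]) ->
        A i = List.nth i (s ++ [j =? 0]) false).
      apply (bs_ext (fun A => exists j, T j A)).
      + intro A. split.
        * intros (j & PA & HA). split; auto. intros i Hi.
          rewrite HA by (rewrite length_app; simpl; lia). now rewrite app_nth1.
        * intros (PA & HA). exists (if A (length s) then 0 else 1). split; auto.
          intros i Hi. rewrite length_app in Hi. simpl in Hi.
          destruct (Nat.eq_dec i (length s)) as [->|].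
          { rewrite app_nth2, Nat.sub_diag by lia. simpl. destruct (A (length s)); reflexivity. }
          { rewrite app_nth1 by lia. apply HA. lia. }
      + apply bs_union. intro j. apply IH. rewrite length_app. simpl. lia. }
  apply (bs_ext (fun A => P A /\ forall i, i < @length bool nil -> A i = List.nth i nil false)).
  - intro A. split; [tauto|]. intro. split; auto. simpl. intros; lia.
  - apply (H n). reflexivity.
Qed.

Lemma borel_or P Q : borel_set P -> borel_set Q -> borel_set (fun A => P A \/ Q A).
Proof.
  intros HP HQ.
  apply (bs_ext (fun A => exists n, (match n with 0 => P | S _ => Q end) A)).
  - intro A. split; [intros [[|n] H]; auto|]. intros [H|H]; [now exists 0|now exists 1].
  - apply bs_union. intros [|n]; auto.
Qed.

Lemma borel_impl P Q : borel_set P -> borel_set Q -> borel_set (fun A => P A -> Q A).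
Proof.
  intros HP HQ. apply (bs_ext (fun A => ~ P A \/ Q A)).
  - intro A. destruct (classic (P A)); tauto.
  - apply borel_or; auto. now apply bs_compl.
Qed.

Lemma borel_and P Q : borel_set P -> borel_set Q -> borel_set (fun A => P A /\ Q A).
Proof.
  intros HP HQ. apply (bs_ext (fun A => ~ (P A -> ~ Q A))).
  - intro A. destruct (classic (P A)), (classic (Q A)); tauto.
  - apply bs_compl, borel_impl; auto. now apply bs_compl.
Qed.

Lemma borel_forall (P : nat -> Cantor -> Prop) :
  (forall n, borel_set (P n)) -> borel_set (fun A => forall n, P n A).
Proof.
  intro HP. apply (bs_ext (fun A => ~ exists n, ~ P n A)).
  - intro A. split; [|firstorder]. intros H n. apply NNPP. firstorder.
  - apply bs_compl, bs_union. intro. now apply bs_compl.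
Qed.

Lemma borel_reindex (h : nat -> nat) P : borel_set P -> borel_set (fun A => P (fun i => A (h i))).
Proof.
  induction 1 as [s|P _ IH|P _ IH|P Q E _ IH].
  - assert (B : exists m, forall i, i < length s -> h i < m).
    { induction (length s) as [|n [m Hm]]; [exists 0; lia|].
      exists (m + S (h n)). intros i Hi. destruct (Nat.eq_dec i n) as [->|]; [lia|].
      specialize (Hm i). lia. }
    destruct B as [m Hm]. apply (borel_finite _ m).
    intros A B E HA i Hi. rewrite <- E; auto.
  - now apply bs_compl.
  - now apply bs_union.
  - eapply bs_ext; [|exact IH]. intro A. apply E.
Qed.

(** Words carry their latest letter first: [tl] is the parent and the head is the last move. *)
Definition word_tree : Tree.
Proof.
  refine {| node := list bool; lev := @length bool; par := @tl bool; root := nil |}.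
  - reflexivity.
  - intros [|]; simpl; auto; discriminate.
  - intros [|]; reflexivity.
  - intro v. exists (true :: v). now split.
Defined.

Fixpoint play (i : bool) (s : list bool -> list bool) (A : Cantor) n : list bool :=
  match n with
  | 0 => nil
  | S n => if Bool.eqb (Nat.even n) i then s (play i s A n)
           else A (Nat.div2 n) :: play i s A n
  end.

Lemma play_run i s A : strat (G := word_tree) s -> run (G := word_tree) (play i s A).
Proof.
  intro Hs. split; [reflexivity|]. intro n. simpl.
  destruct (Bool.eqb (Nat.even n) i); [apply Hs|now split].
Qed.

Lemma play_follows i s A : follows (G := word_tree) i s (play i s A).
Proof. intros n En. simpl. rewrite En, eqb_reflx. reflexivity. Qed.

Definition play_bit i s A n := hd false (play i s A (S n)).

Lemma play_opponent i s A n : Nat.even n <> i -> play_bit i s A n = A (Nat.div2 n).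
Proof.
  intro En. unfold play_bit. simpl.
  destruct (Bool.eqb (Nat.even n) i) eqn:E; [|reflexivity].
  apply eqb_prop in E. tauto.
Qed.

Lemma play_agree i s A B n : agree A B n -> play i s A n = play i s B n.
Proof.
  intro E. assert (H : forall m, m <= n -> play i s A m = play i s B m).
  { induction m; intro L; auto. simpl. rewrite IHm by lia.
    destruct (Bool.eqb (Nat.even m) i); auto. f_equal. apply E.
    pose proof (Nat.le_div2 m). destruct m; simpl; [lia|].
    pose proof (Nat.le_div2_diag_l (S m)). simpl in *. lia. }
  now apply H.
Qed.

Lemma play_cont i s h : cont_cantor (fun A j => play_bit i s A (h j)).
Proof.
  intros A n.
  assert (B : exists m, forall j, j < n -> S (h j) <= m).
  { induction n as [|n [m Hm]]; [exists 0; lia|].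
    exists (m + S (h n)). intros j Hj. destruct (Nat.eq_dec j n) as [->|]; [lia|].
    specialize (Hm j). lia. }
  destruct B as [m Hm]. exists m. intros B E j Hj. unfold play_bit.
  rewrite (play_agree i s A B (S (h j))); auto.
  intros l Hl. apply E. specialize (Hm j Hj). lia.
Qed.

Lemma even_2 j : Nat.even (2 * j) = true.
Proof. now rewrite Nat.even_mul. Qed.

Lemma even_2S j : Nat.even (S (2 * j)) = false.
Proof. rewrite Nat.even_succ, <- Nat.negb_even, even_2. reflexivity. Qed.

Lemma wadge_dichotomy (W P1 P0 : Cantor -> Prop) :
  borel_set W -> borel_set P1 -> borel_set P0 ->
  (exists k, cont_cantor k /\ forall A, (W A -> P1 (k A)) /\ (~ W A -> P0 (k A))) \/
  (exists k, cont_cantor k /\ forall B, (P1 B -> ~ W (k B)) /\ (P0 B -> W (k B))).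
Proof.
  intros HW H1 H0.
  set (ev := fun (z : Cantor) j => z (2 * j)). set (od := fun (z : Cantor) j => z (S (2 * j))).
  set (Q := fun z => (W (ev z) -> P1 (od z)) /\ (~ W (ev z) -> P0 (od z))).
  assert (HQ : borel_set (fun z => ~ Q z)).
  { assert (borel_set (fun z => W (ev z))) by (unfold ev; now apply borel_reindex).
    assert (borel_set (fun z => P1 (od z))) by (unfold od; now apply (borel_reindex (fun j => S (2 * j)))).
    assert (borel_set (fun z => P0 (od z))) by (unfold od; now apply (borel_reindex (fun j => S (2 * j)))).
    apply bs_compl, borel_and; apply borel_impl; auto. now apply bs_compl. }
  destruct (borel_determinacy _ word_tree (hd false) HQ) as [(s & Hs & Ws)|(s & Hs & Ws)].
  - right. exists (fun A j => play_bit true s A (2 * j)). split; [apply play_cont|]. intro B.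
    specialize (Ws (play true s B) (play_run _ _ _ Hs) (play_follows _ _ _)).
    change (~ Q (play_bit true s B)) in Ws. unfold Q in Ws.
    assert (E : od (play_bit true s B) = B).
    { apply functional_extensionality. intro j. unfold od.
      rewrite play_opponent by (rewrite even_2S; discriminate).
      f_equal. apply Nat.div2_succ_double. }
    rewrite E in Ws. unfold ev in Ws.
    destruct (classic (W (fun j => play_bit true s B (2 * j)))); tauto.
  - left. exists (fun A j => play_bit false s A (S (2 * j))). split; [apply play_cont|]. intro A.
    specialize (Ws (play false s A) (play_run _ _ _ Hs) (play_follows _ _ _)).
    change (~ ~ Q (play_bit false s A)) in Ws. apply NNPP in Ws. unfold Q in Ws.
    assert (E : ev (play_bit false s A) = A).
    { apply functional_extensionality. intro j. unfold ev.
      rewrite play_opponent by (rewrite even_2; discriminate).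
      f_equal. apply Nat.div2_double. }
    rewrite E in Ws. exact Ws.
Qed.

(** * Countable ordinals and discrete limit classes *)

Lemma olt_S_iff x y : olt x (OS y) <-> ole x y.
Proof. split; [now inversion 1|apply olt_S]. Qed.

Lemma ole_S_iff x y : ole (OS x) y <-> olt x y.
Proof. split; [now inversion 1|apply ole_S]. Qed.

Lemma ole_L_iff f y : ole (OL f) y <-> forall n, ole (f n) y.
Proof. split; [now inversion 1|apply ole_L]. Qed.

Lemma olt_L_iff x g : olt x (OL g) <-> exists n, olt x (g n).
Proof. split; [inversion 1; eauto|intros [n H]; now apply (olt_L _ _ n)]. Qed.

Lemma not_olt_Z x : ~ olt x OZ.
Proof. inversion 1. Qed.

Scheme ole_mut := Minimality for ole Sort Prop
  with olt_mut := Minimality for olt Sort Prop.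
Combined Scheme ole_olt_ind from ole_mut, olt_mut.

Lemma ole_olt_trans_l :
  (forall x y, ole x y -> forall z, (ole y z -> ole x z) /\ (olt y z -> olt x z)) /\
  (forall x y, olt x y -> forall z, ole y z -> olt x z).
Proof.
  assert (Lift : forall x y, (forall z, ole y z -> ole x z) -> forall z, olt y z -> olt x z).
  { intros x y H z. induction z as [|z IH|g IH].
    - intro C. now apply not_olt_Z in C.
    - rewrite !olt_S_iff. apply H.
    - rewrite !olt_L_iff. intros [n Hn]. exists n. auto. }
  assert (M : (forall x y, ole x y -> forall z, ole y z -> ole x z) /\
    (forall x y, olt x y -> forall z, ole y z -> olt x z)).
  { apply ole_olt_ind.
    - intros; apply ole_Z.
    - intros x y _ IH z H. now apply ole_S, IH.
    - intros f y _ IH z H. apply ole_L. auto.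
    - intros x y _ IH z H. apply ole_S_iff in H. exact (Lift x y IH z H).
    - intros x g n _ IH z H. apply IH. now apply ole_L_iff. }
  destruct M as [M1 M2]. split; auto. intros x y H z. split; [now apply M1|].
  apply Lift. now apply M1.
Qed.

Lemma ole_trans x y z : ole x y -> ole y z -> ole x z.
Proof. intros H. now apply ole_olt_trans_l. Qed.

Lemma ole_olt_trans x y z : ole x y -> olt y z -> olt x z.
Proof. intros H. now apply ole_olt_trans_l. Qed.

Lemma olt_ole_trans x y z : olt x y -> ole y z -> olt x z.
Proof. intros H. now apply ole_olt_trans_l. Qed.

Lemma ole_weaken :
  (forall x y, ole x y -> ole x (OS y)) /\ (forall x y, olt x y -> ole x y).
Proof.
  assert (M : (forall x y, ole x y -> ole x (OS y)) /\
    (forall x y, olt x y -> ole x y /\ olt x (OS y))).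
  { apply ole_olt_ind.
    - intros; apply ole_Z.
    - intros x y _ [_ IH]. now apply ole_S.
    - intros f y _ IH. now apply ole_L.
    - intros x y H IH. split; auto. now apply olt_S.
    - intros x g n H [IH _].
      assert (ole x (OL g)).
      { clear H. induction x as [|x _|f IHf].
        - apply ole_Z.
        - apply ole_S_iff in IH. apply ole_S, olt_L_iff. eauto.
        - apply ole_L. intro m. apply IHf. now apply ole_L_iff. }
      split; auto. now apply olt_S. }
  split; apply M.
Qed.

Lemma olt_ole x y : olt x y -> ole x y.
Proof. apply ole_weaken. Qed.

Lemma ole_refl x : ole x x.
Proof.
  induction x as [|x IH|f IH].
  - apply ole_Z.
  - now apply ole_S, olt_S.
  - apply ole_L. intro n. specialize (IH n). revert IH. generalize (f n) at 1 3.
    intro y. induction y as [|y _|g IHg]; intro H.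
    + apply ole_Z.
    + apply ole_S, olt_L_iff. exists n. now apply ole_S_iff.
    + apply ole_L. intro m. apply IHg. now apply ole_L_iff.
Qed.

Lemma ole_L_ub f n : ole (f n) (OL f).
Proof. now apply ole_L_iff, ole_refl. Qed.

Lemma olt_trans x y z : olt x y -> olt y z -> olt x z.
Proof. intros H K. eapply olt_ole_trans; eauto. now apply olt_ole. Qed.

Lemma ole_total x : forall y, ole x y \/ olt y x.
Proof.
  induction x as [|x IH|f IH]; intro y.
  - left. apply ole_Z.
  - rewrite ole_S_iff, olt_S_iff. induction y as [|y _|g IHg].
    + right. apply ole_Z.
    + rewrite olt_S_iff, ole_S_iff. apply IH.
    + destruct (classic (exists n, olt x (g n))) as [H|H].
      * left. now apply olt_L_iff.
      * right. apply ole_L. intro n. destruct (IHg n) as [K|K]; auto.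
        exfalso. eauto.
  - destruct (classic (exists n, olt y (f n))) as [H|H].
    + right. now apply olt_L_iff.
    + left. apply ole_L. intro n. destruct (IH n y); auto. exfalso; eauto.
Qed.

Lemma olt_irrefl x : ~ olt x x.
Proof.
  induction x as [|x IH|f IH].
  - apply not_olt_Z.
  - rewrite olt_S_iff, ole_S_iff. exact IH.
  - rewrite olt_L_iff. intros [n H]. apply (IH n). eapply ole_olt_trans; [apply ole_L_ub|exact H].
Qed.

(** [olt] is not the subterm relation and different trees denote the same ordinal, so accessibility
    is proved for everything at most [x]. *)
Lemma olt_wf : well_founded olt.
Proof.
  assert (H : forall x y, ole y x -> Acc olt y).
  { induction x as [|x IH|f IH]; intros y Hy; constructor; intros z Hz.
    - exfalso. apply (not_olt_Z z). eapply olt_ole_trans; eauto.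
    - apply IH. apply olt_S_iff. eapply olt_ole_trans; eauto.
    - assert (Hz' : olt z (OL f)) by (eapply olt_ole_trans; eauto).
      apply olt_L_iff in Hz' as [n Hn]. apply (IH n). now apply olt_ole. }
  intro x. apply (H x), ole_refl.
Qed.

Lemma oeq_sym x y : oeq x y -> oeq y x.
Proof. unfold oeq; tauto. Qed.

Lemma oeq_trans x y z : oeq x y -> oeq y z -> oeq x z.
Proof. intros [] []. split; eapply ole_trans; eauto. Qed.

Lemma oeq_S_inv x y : oeq (OS x) (OS y) -> oeq x y.
Proof. unfold oeq. now rewrite !ole_S_iff, !olt_S_iff. Qed.

Lemma ofin_lt m n : m < n -> olt (ofin m) (ofin n).
Proof.
  intro L. induction L; simpl; apply olt_S; [apply ole_refl|now apply olt_ole].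
Qed.

Lemma ofin_inj m n : oeq (ofin m) (ofin n) -> m = n.
Proof.
  intros [H K]. destruct (Nat.lt_trichotomy m n) as [L|[L|L]]; auto; exfalso;
    apply ofin_lt in L.
  - apply (olt_irrefl (ofin m)). eapply olt_ole_trans; eauto.
  - apply (olt_irrefl (ofin n)). eapply olt_ole_trans; eauto.
Qed.

Lemma choice {A B} (R : A -> B -> Prop) :
  (forall x, exists y, R x y) -> exists f, forall x, R x (f x).
Proof.
  intro H. exists (fun x => proj1_sig (constructive_indefinite_description _ (H x))).
  intro x. apply proj2_sig.
Qed.

(** * Discrete limits of locally constant functions *)

Definition loc_const {T} (F : Cantor -> T) :=
  forall A, exists n, forall B, agree A B n -> F A = F B.

Inductive dlim {T : Type} : Ord -> (Cantor -> T) -> Prop :=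
| dlim_const be F : loc_const F -> dlim be F
| dlim_lim be F (g : nat -> Cantor -> T) :
    (forall n, exists ga, olt ga be /\ dlim ga (g n)) ->
    (forall A, exists N, forall n, N <= n -> g n A = F A) -> dlim be F.

Lemma dlim_mono {T} be ga (F : Cantor -> T) : dlim be F -> ole be ga -> dlim ga F.
Proof.
  intros H L. destruct H as [be F HF|be F g Hg HF].
  - now apply dlim_const.
  - apply (dlim_lim _ _ g); auto. intro n. destruct (Hg n) as (de & Hd & HD).
    exists de. split; auto. eapply olt_ole_trans; eauto.
Qed.

Lemma dlim_approx {T} be (F : Cantor -> T) : (exists ga, olt ga be) -> dlim be F ->
  exists g : nat -> Cantor -> T, (forall n, exists ga, olt ga be /\ dlim ga (g n)) /\
    forall A, exists N, forall n, N <= n -> g n A = F A.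
Proof.
  intros [ga Hga] H. destruct H as [be F HF|be F g Hg HF]; [|eauto].
  exists (fun _ => F). split.
  - intros _. exists ga. split; auto. now apply dlim_const.
  - intro A. now exists 0.
Qed.

Lemma loc_const_family {T I} (ls : list I) (F : I -> Cantor -> T) :
  (forall i, In i ls -> loc_const (F i)) ->
  forall A, exists n, forall B, agree A B n -> forall i, In i ls -> F i A = F i B.
Proof.
  intros H A. induction ls as [|i ls IH].
  - exists 0. intros B _ i [].
  - destruct IH as [n Hn]; [intros; apply H; now right|].
    destruct (H i (or_introl eq_refl) A) as [m Hm].
    exists (n + m). intros B E j [->|Hj].
    + apply Hm. intros l Hl; apply E; lia.
    + apply Hn; auto. intros l Hl; apply E; lia.
Qed.

Lemma dlim_OZ {T} be (F : Cantor -> T) : ~ (exists ga, olt ga be) -> dlim be F -> loc_const F.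
Proof.
  intros N H. destruct H as [be F HF|be F g Hg _]; auto.
  destruct (Hg 0) as (ga & L & _). exfalso. eauto.
Qed.

Lemma family_bound {T I} be (ls : list I) (F : I -> Cantor -> T) : (exists ga, olt ga be) ->
  (forall i, In i ls -> exists ga, olt ga be /\ dlim ga (F i)) ->
  exists ga, olt ga be /\ forall i, In i ls -> dlim ga (F i).
Proof.
  intros H0 H. induction ls as [|i ls IH].
  - destruct H0 as [ga L]. exists ga. split; auto. intros i [].
  - destruct IH as (ga & L & IH); [intros; apply H; now right|].
    destruct (H i (or_introl eq_refl)) as (de & L' & Hi).
    destruct (ole_total ga de) as [K|K].
    + exists de. split; auto. intros j [<-|Hj]; auto. eapply dlim_mono; eauto.
    + exists ga. split; auto. intros j [<-|Hj]; auto. eapply dlim_mono; [eauto|now apply olt_ole].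
Qed.

(** No continuity of [H] is needed: when finitely many values are eventually constant, so is any
    function of them, and finitely many classes below [be] have a common bound below [be]. *)
Lemma dlim_combine {T U I} (ls : list I) be (F : I -> Cantor -> T) (H : Cantor -> U) :
  (forall i, In i ls -> dlim be (F i)) ->
  (forall A B, (forall i, In i ls -> F i A = F i B) -> H A = H B) -> dlim be H.
Proof.
  intros HF HH.
  (* [G] is defined on all lists of values, so it also applies to lists produced by approximations
     that no point realises for the [F i]. *)
  set (G := fun w : list T => epsilon (inhabits (H (fun _ => false)))
    (fun y => exists A, map (fun i => F i A) ls = w /\ y = H A)).
  assert (HG : forall A, H A = G (map (fun i => F i A) ls)).
  { intro A. unfold G.
    destruct (epsilon_spec (inhabits (H (fun _ => false)))
      (fun y => exists B, map (fun i => F i B) ls = map (fun i => F i A) ls /\ y = H B))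
      as (B & E & ->); [now exists (H A), A|].
    apply HH. intros i Hi. symmetry. exact (ext_in_map E i Hi). }
  clearbody G. clear HH. revert F H HF HG.
  induction be as [be IH] using (well_founded_induction olt_wf). intros F H HF HG.
  destruct (classic (exists ga, olt ga be)) as [Hb|Hb].
  - assert (HA : forall i, exists g : nat -> Cantor -> T, In i ls ->
      (forall n, exists ga, olt ga be /\ dlim ga (g n)) /\
      forall A, exists N, forall n, N <= n -> g n A = F i A).
    { intro i. destruct (classic (In i ls)) as [Hi|Hi].
      - destruct (dlim_approx be (F i) Hb (HF i Hi)) as [g Hg]. now exists g.
      - exists (fun _ => F i). tauto. }
    apply choice in HA as [g Hg].
    apply (dlim_lim _ _ (fun n A => G (map (fun i => g i n A) ls))).
    + intro n.
      destruct (family_bound be ls (fun i => g i n) Hb) as (ga & L & Hga).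
      { intros i Hi. now apply Hg. }
      exists ga. split; auto. apply (IH ga L (fun i => g i n)); auto.
    + intro A.
      assert (HN : exists N, forall n, N <= n -> forall i, In i ls -> g i n A = F i A).
      { clear - Hg. induction ls as [|i ls IH]; [exists 0; intros ? ? ? []|].
        destruct IH as [N HN]; [intros j Hj; apply Hg; now right|].
        destruct (proj2 (Hg i (or_introl eq_refl)) A) as [M HM].
        exists (N + M). intros n Hn j [<-|Hj]; [apply HM; lia|apply HN; auto; lia]. }
      destruct HN as [N HN]. exists N. intros n Hn. rewrite HG. f_equal.
      apply map_ext_in. auto.
  - apply dlim_const. intro A.
    destruct (loc_const_family ls F (fun i Hi => dlim_OZ be (F i) Hb (HF i Hi)) A) as [n Hn].
    exists n. intros B E. rewrite !HG. f_equal. apply map_ext_in. intros i Hi. now apply Hn.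
Qed.

Lemma dlim_preimage {T} be (F : Cantor -> T) k :
  cont_cantor k -> dlim be F -> dlim be (fun A => F (k A)).
Proof.
  intros Hk H. revert F H. induction be as [be IH] using (well_founded_induction olt_wf).
  intros F H. destruct H as [be F HF|be F g Hg HF].
  - apply dlim_const. intro A. destruct (HF (k A)) as [n Hn]. destruct (Hk A n) as [m Hm].
    exists m. intros B E. now apply Hn, Hm.
  - apply (dlim_lim _ _ (fun n A => g n (k A))); auto.
    intro n. destruct (Hg n) as (ga & L & Hga). exists ga. split; auto.
Qed.

Lemma borel_dlim be (F : Cantor -> bool) : dlim be F -> borel_set (fun A => F A = true).
Proof.
  revert F. induction be as [be IH] using (well_founded_induction olt_wf).
  intros F H. destruct H as [be F HF|be F g Hg HF].
  - apply (bs_ext (fun A => exists n, forall B, agree A B n -> F B = true)).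
    + intro A. split.
      * intros [n Hn]. apply Hn. now intros i _.
      * intro E. destruct (HF A) as [n Hn]. exists n. intros B HB. rewrite <- E. symmetry. auto.
    + apply bs_union. intro n. apply (borel_finite _ n). intros A B E H C HC.
      apply H. intros i Hi. rewrite E; auto.
  - apply (bs_ext (fun A => exists N, forall n, N <= n -> g n A = true)).
    + intro A. destruct (HF A) as [M HM]. split.
      * intros [N HN]. rewrite <- (HM (N + M)) by lia. apply HN. lia.
      * intro E. exists M. intros n Hn. now rewrite HM.
    + apply bs_union. intro N. apply borel_forall. intro n.
      destruct (Hg n) as (ga & L & Hga).
      apply borel_impl; [apply (borel_finite _ 0); auto|]. now apply (IH ga).
Qed.

Lemma dlim_baire be (F : Cantor -> R) : dlim be F -> baire be F.
Proof.
  revert F. induction be as [be IH] using (well_founded_induction olt_wf).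
  intros F H. destruct H as [be F HF|be F g Hg HF].
  - apply baire_cont. intros A eps He. destruct (HF A) as [n Hn]. exists n.
    intros B E. rewrite (Hn B E). now rewrite Rminus_diag, Rabs_R0.
  - apply (baire_lim _ _ g).
    + intro n. destruct (Hg n) as (ga & L & Hga). eauto.
    + intros A eps He. destruct (HF A) as [N HN]. exists N. intros n Hn.
      rewrite HN by auto. unfold Rdist. now rewrite Rminus_diag, Rabs_R0.
Qed.

(** * Reals found by searching through tests of class [al] *)

Section Approximation.
Context (al : Ord) (f : Cantor -> R) (c : nat -> nat -> Cantor -> bool) (q : nat -> nat -> R).
Context (Hc : forall k i, dlim al (c k i)) (Hex : forall k A, exists i, c k i A = true)
  (Hq : forall k i A, c k i A = true -> (Rabs (f A - q k i) < / INR (S k))%R).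

Lemma small_inv eps : (eps > 0)%R -> exists k, (2 * / INR (S k) < eps)%R.
Proof.
  intro He. destruct (archimed_cor1 (eps / 2)) as (n & Hn & Ln); [lra|].
  exists n. assert (0 < INR n)%R by (now apply lt_0_INR).
  assert (/ INR (S n) <= / INR n)%R; [|lra].
  apply Rinv_le_contravar; auto. rewrite S_INR. lra.
Qed.

Lemma approx_continuous : ~ (exists ga, olt ga al) -> baire al f.
Proof.
  intro N. apply baire_cont. intros A eps He.
  destruct (small_inv eps He) as [k Hk]. destruct (Hex k A) as [i Hi].
  destruct (dlim_OZ al (c k i) N (Hc k i) A) as [n Hn]. exists n. intros B E.
  pose proof (Hq k i A Hi) as HA. rewrite (Hn B E) in Hi. pose proof (Hq k i B Hi) as HB.
  replace (f A - f B)%R with ((f A - q k i) - (f B - q k i))%R by ring.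
  eapply Rle_lt_trans; [apply Rabs_triang|]. rewrite Rabs_Ropp. lra.
Qed.

Context (g : nat -> nat -> nat -> Cantor -> bool).
Context (Hg : forall k i n, exists ga, olt ga al /\ dlim ga (g k i n))
  (Hgc : forall k i A, exists N, forall n, N <= n -> g k i n A = c k i A).

(** Stage [n] of the search at precision [k]. It stabilises for each [k], but at a stage depending
    on [k] and [A], so no single precision is reliable at stage [n] and [estimate] has to weigh all
    of them. *)
Definition selection n A k : option nat :=
  if le_dec k n then find (fun i => g k i n A) (seq 0 (S n)) else None.

Definition fits (s : nat -> option nat) K y :=
  forall k, k <= K -> exists i, s k = Some i /\ (Rabs (y - q k i) <= / INR (S k))%R.

(* A real meeting as many of the first [n] selected precision constraints as possible. *)
Definition estimate n (s : nat -> option nat) : R := epsilon (inhabits 0%R)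
  (fun y => exists K, K <= n /\ fits s K y /\ forall K' y', K' <= n -> fits s K' y' -> K' <= K).

Lemma find_seq_least (p : nat -> bool) n i : i <= n -> p i = true ->
  (forall j, j < i -> p j = false) -> find p (seq 0 (S n)) = Some i.
Proof.
  intros L Hi Hj. replace (S n) with (i + S (n - i)) by lia. rewrite seq_app.
  assert (E : forall l m, m + l <= i -> find p (seq m l) = None).
  { induction l as [|l IH]; intros m Hm; simpl; auto. rewrite Hj by lia. apply IH. lia. }
  assert (F : forall l1 l2, find p l1 = None -> find p (l1 ++ l2) = find p l2).
  { induction l1 as [|a l1 IH]; simpl; auto. intros l2 H. destruct (p a); [discriminate|auto]. }
  rewrite F by (apply E; lia). simpl. now rewrite Hi.
Qed.

Lemma selection_stable k A : exists i N, c k i A = true /\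
  forall n, N <= n -> selection n A k = Some i.
Proof.
  destruct (exists_least _ (Hex k A)) as [i [Hi Hmin]].
  assert (HN : exists N, forall n, N <= n -> forall j, j <= i -> g k j n A = c k j A).
  { clear - Hgc. induction i as [|i [N HN]].
    - destruct (Hgc k 0 A) as [N HN]. exists N. intros n Hn j Hj.
      replace j with 0 by lia. auto.
    - destruct (Hgc k (S i) A) as [M HM]. exists (N + M). intros n Hn j Hj.
      destruct (Nat.eq_dec j (S i)) as [->|]; [apply HM|apply HN]; lia. }
  destruct HN as [N HN]. exists i, (N + i + k). split; auto. intros n Hn.
  unfold selection. destruct le_dec; [|lia]. apply find_seq_least; [lia| |].
  - rewrite HN; auto; lia.
  - intros j Hj. rewrite HN by lia. destruct (c k j A) eqn:E; auto.
    specialize (Hmin j E). lia.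
Qed.

Lemma estimate_spec n s K y : K <= n -> fits s K y ->
  exists K', K <= K' /\ fits s K' (estimate n s).
Proof.
  intros L Hy.
  assert (Hmax : exists K0, K0 <= n /\ (exists y, fits s K0 y) /\
    forall K' y', K' <= n -> fits s K' y' -> K' <= K0).
  { set (P := fun m => m <= n /\ exists y, fits s (n - m) y).
    destruct (exists_least P) as [m [[Lm [z Hz]] Hm]].
    { exists (n - K). split; [lia|]. exists y. now replace (n - (n - K)) with K by lia. }
    exists (n - m). split; [lia|]. split; [eauto|]. intros K' y' LK Hy'.
    assert (m <= n - K'); [|lia]. apply Hm. split; [lia|]. exists y'.
    now replace (n - (n - K')) with K' by lia. }
  destruct Hmax as (K0 & LK0 & [z Hz] & Hm).
  destruct (epsilon_spec (inhabits 0%R) (fun y => exists K, K <= n /\ fits s K y /\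
    forall K' y', K' <= n -> fits s K' y' -> K' <= K)) as (K' & LK' & HK' & HmK').
  { exists z, K0. auto. }
  exists K'. split; auto. now apply (HmK' K y).
Qed.

(** Once the selections up to [k] are final, [f A] meets them; the estimate, being optimal, meets
    them too, and two reals meeting constraint [k] differ by at most [2 / (k + 1)]. *)
Lemma estimate_cv A : Un_cv (fun n => estimate n (selection n A)) (f A).
Proof.
  intros eps He. destruct (small_inv eps He) as [k Hk].
  assert (HN : exists N, forall n, N <= n -> fits (selection n A) k (f A)).
  { clear Hk. induction k as [|k [N HN]].
    - destruct (selection_stable 0 A) as (i & N & Hi & HN). exists N. intros n Hn j Hj.
      replace j with 0 by lia. exists i. split; auto. now apply Rlt_le, Hq.
    - destruct (selection_stable (S k) A) as (i & M & Hi & HM). exists (N + M).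
      intros n Hn j Hj. destruct (Nat.eq_dec j (S k)) as [->|].
      + exists i. split; [apply HM; lia|]. now apply Rlt_le, Hq.
      + apply (HN n); lia. }
  destruct HN as [N HN]. exists (N + k). intros n Hn.
  assert (Hf : fits (selection n A) k (f A)) by (apply HN; lia).
  destruct (estimate_spec n (selection n A) k (f A)) as (K & LK & HK); [lia|auto|].
  destruct (Hf k (Nat.le_refl k)) as (i & Ei & Bi).
  destruct (HK k LK) as (j & Ej & Bj).
  assert (j = i) by congruence. subst j. unfold Rdist.
  set (y := estimate n (selection n A)) in *.
  replace (y - f A)%R with ((y - q k i) - (f A - q k i))%R by ring.
  eapply Rle_lt_trans; [apply Rabs_triang|]. rewrite Rabs_Ropp. lra.
Qed.

(** Stage [n] reads only [g k i n] for [k, i <= n]: finitely many functions, of one common class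
    below [al]. *)
Lemma approx_limit : (exists ga, olt ga al) -> baire al f.
Proof.
  intro H0. apply (baire_lim _ _ (fun n A => estimate n (selection n A))); [|exact estimate_cv].
  intro n. set (ls := list_prod (seq 0 (S n)) (seq 0 (S n))).
  destruct (family_bound al ls (fun ki => g (fst ki) (snd ki) n) H0) as (ga & L & Hga); auto.
  exists ga. split; auto. apply dlim_baire.
  apply (dlim_combine ls ga (fun ki => g (fst ki) (snd ki) n)); auto.
  intros A B E. f_equal. apply functional_extensionality. intro k. unfold selection.
  destruct le_dec as [Lk|]; auto.
  assert (E' : forall i, i <= n -> g k i n A = g k i n B).
  { intros i Li. apply (E (k, i)). apply in_prod; apply in_seq; lia. }
  assert (F : forall l, (forall i, In i l -> i <= n) ->
    find (fun i => g k i n A) l = find (fun i => g k i n B) l).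
  { induction l as [|i l IH]; simpl; auto. intro Hl. rewrite E', IH; auto. }
  apply F. intros i Hi. apply in_seq in Hi. lia.
Qed.

End Approximation.

Lemma baire_of_approximations al f :
  (forall k, exists (c : nat -> Cantor -> bool) (q : nat -> R),
     (forall i, dlim al (c i)) /\ (forall A, exists i, c i A = true) /\
     forall i A, c i A = true -> (Rabs (f A - q i) < / INR (S k))%R) ->
  baire al f.
Proof.
  intro H.
  assert (H' : exists cq : nat -> (nat -> Cantor -> bool) * (nat -> R), forall k,
     (forall i, dlim al (fst (cq k) i)) /\ (forall A, exists i, fst (cq k) i A = true) /\
     forall i A, fst (cq k) i A = true -> (Rabs (f A - snd (cq k) i) < / INR (S k))%R).
  { apply (choice (fun k (cq : (nat -> Cantor -> bool) * (nat -> R)) =>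
     (forall i, dlim al (fst cq i)) /\ (forall A, exists i, fst cq i A = true) /\
     forall i A, fst cq i A = true -> (Rabs (f A - snd cq i) < / INR (S k))%R)).
    intro k. destruct (H k) as (c & q & ?). now exists (c, q). }
  destruct H' as [cq Hcq]. set (c := fun k => fst (cq k)). set (q := fun k => snd (cq k)).
  assert (Hc : forall k i, dlim al (c k i)) by (intro k; apply Hcq).
  assert (Hex : forall k A, exists i, c k i A = true) by (intro k; apply Hcq).
  assert (Hq : forall k i A, c k i A = true -> (Rabs (f A - q k i) < / INR (S k))%R)
    by (intro k; apply Hcq).
  destruct (classic (exists ga, olt ga al)) as [H0|H0].
  - assert (Hg : exists g : nat * nat -> nat -> Cantor -> bool, forall ki,
      (forall n, exists ga, olt ga al /\ dlim ga (g ki n)) /\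
      forall A, exists N, forall n, N <= n -> g ki n A = c (fst ki) (snd ki) A).
    { apply (choice (fun ki (g : nat -> Cantor -> bool) =>
        (forall n, exists ga, olt ga al /\ dlim ga (g n)) /\
        forall A, exists N, forall n, N <= n -> g n A = c (fst ki) (snd ki) A)).
      intro ki. now apply dlim_approx. }
    destruct Hg as [g Hg].
    apply (approx_limit al f c q Hex Hq (fun k i => g (k, i))); auto.
    + intros k i n. apply Hg.
    + intros k i A. apply (proj2 (Hg (k, i)) A).
  - now apply (approx_continuous al f c q).
Qed.

(** * Jumps and the hyperarithmetic hierarchy *)

Lemma bounded_choice (P : nat -> nat -> Prop) n :
  (forall m N N', P m N -> N <= N' -> P m N') -> (forall m, m < n -> exists N, P m N) ->
  exists N, forall m, m < n -> P m N.
Proof.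
  intros Mono H. induction n as [|n IH]; [exists 0; lia|].
  destruct IH as [N HN]; [auto|]. destruct (H n) as [M HM]; [lia|].
  exists (N + M). intros m Hm. destruct (Nat.eq_dec m n) as [->|].
  - apply (Mono n M); auto; lia.
  - apply (Mono m N); [apply HN|]; lia.
Qed.

Lemma agree_le A B n m : agree A B n -> m <= n -> agree A B m.
Proof. intros H L i Hi. apply H. lia. Qed.

Lemma eval_use X p x y : eval X p x y ->
  exists n, forall X', agree X X' n -> eval X' p x y.
Proof.
  (* Derivations in [ev_mu] lie under an existential, where the generated induction principle gives
     no hypothesis; the recursion is on the derivation itself. *)
  revert p x y. fix IH 4. intros p x y H. destruct H as
    [x|x|x|x|x|x|f g x y z Hg Hf|f g x y1 y2 Hf Hg|f g x y Hf|f g x k r y Hr Hg|f x n H0 Hm].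
  - exists 0. intros. apply ev_zero.
  - exists 0. intros. apply ev_succ.
  - exists 0. intros. apply ev_id.
  - exists 0. intros. apply ev_fst.
  - exists 0. intros. apply ev_snd.
  - exists (S x). intros X' E. rewrite (E x) by lia. apply ev_oracle.
  - destruct (IH _ _ _ Hg) as [n Hn], (IH _ _ _ Hf) as [m Hm]. exists (n + m).
    intros X' E. apply ev_comp with y; [apply Hn|apply Hm]; apply (agree_le _ _ _ _ E); lia.
  - destruct (IH _ _ _ Hf) as [n Hn], (IH _ _ _ Hg) as [m Hm]. exists (n + m).
    intros X' E. apply ev_pair; [apply Hn|apply Hm]; apply (agree_le _ _ _ _ E); lia.
  - destruct (IH _ _ _ Hf) as [n Hn]. exists n. intros X' E. apply ev_rec0. auto.
  - destruct (IH _ _ _ Hr) as [n Hn], (IH _ _ _ Hg) as [m Hm]. exists (n + m).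
    intros X' E. apply ev_recS with r; [apply Hn|apply Hm]; apply (agree_le _ _ _ _ E); lia.
  - destruct (IH _ _ _ H0) as [N HN].
    assert (HM : exists M, forall m, m < n -> forall X', agree X X' M ->
      exists k, eval X' f (pair x m) (S k)).
    { apply (bounded_choice (fun m M => forall X', agree X X' M ->
        exists k, eval X' f (pair x m) (S k))).
      - intros m M M' HM L X' E. apply HM. apply (agree_le _ _ _ _ E L).
      - intros m Lm. destruct (Hm m Lm) as [k Hk].
        destruct (IH _ _ _ Hk) as [M HM]. exists M. eauto. }
    destruct HM as [M HM]. exists (N + M). intros X' E. apply ev_mu.
    + apply HN, (agree_le _ _ _ _ E). lia.
    + intros m Lm. apply (HM m Lm), (agree_le _ _ _ _ E). lia.
Qed.

Definition open_class (P : Cantor -> Prop) :=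
  forall X, P X -> exists n, forall X', agree X X' n -> P X'.

Lemma jump_open e : open_class (fun X => jump X e).
Proof.
  intros X (y & p & Ep & H). destruct (eval_use _ _ _ _ H) as [n Hn].
  exists n. intros X' E. exists y, p. auto.
Qed.

(** The first [s] bits of [X] already force [P]. This replaces running a computation for [s] steps,
    as only the use of the oracle matters. *)
Definition stage (P : Cantor -> Prop) s X : bool :=
  if excluded_middle_informative (forall X', agree X X' s -> P X') then true else false.

Lemma stage_true P s X : stage P s X = true <-> forall X', agree X X' s -> P X'.
Proof. unfold stage. destruct excluded_middle_informative; split; auto; discriminate. Qed.

Lemma stage_open P X : open_class P -> (P X <-> exists s, stage P s X = true).
Proof.
  intro O. split.
  - intro H. destruct (O X H) as [n Hn]. exists n. now apply stage_true.
  - intros [s H]. apply (proj1 (stage_true P s X) H). now intros i _.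
Qed.

Lemma stage_mono P s t X : s <= t -> stage P s X = true -> stage P t X = true.
Proof.
  rewrite !stage_true. intros L H X' E. apply H, (agree_le _ _ _ _ E L).
Qed.

Lemma stage_agree P s X Y : agree X Y s -> stage P s X = stage P s Y.
Proof.
  intro E. unfold stage. do 2 destruct excluded_middle_informative; auto; exfalso;
    apply n; intros X' E'; apply p; intros i Hi; rewrite <- E' by auto;
    [|symmetry]; auto.
Qed.

Lemma dlim_stage be (H : Cantor -> Cantor) P s :
  (forall i, dlim be (fun A => H A i)) -> dlim be (fun A => stage P s (H A)).
Proof.
  intro HH. apply (dlim_combine (seq 0 s) be (fun i A => H A i)); auto.
  intros A B E. apply stage_agree. intros i Hi. apply E, in_seq. lia.
Qed.

Lemma tobool_true P i : tobool P i = true <-> P i.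
Proof. unfold tobool. destruct excluded_middle_informative; split; auto; discriminate. Qed.

Lemma bool_ext b b' : (b = true <-> b' = true) -> b = b'.
Proof. destruct b, b'; intuition congruence. Qed.

Lemma pred_ext {T} (P Q : T -> Prop) : (forall i, P i <-> Q i) -> P = Q.
Proof.
  intro H. apply functional_extensionality. intro i.
  now apply propositional_extensionality.
Qed.

(** A jump costs one class: [stage] at [s] reads finitely many bits, which share a class below [be],
    and increases with [s] to membership in the jump. *)
Lemma dlim_jump be (H : Cantor -> Cantor) e :
  (forall i, exists ga, olt ga be /\ dlim ga (fun A => H A i)) ->
  dlim be (fun A => tobool (jump (H A)) e).
Proof.
  intro HH. set (P := fun X => jump X e).
  apply (dlim_lim _ _ (fun s A => stage P s (H A))).
  - intro s. destruct (family_bound be (seq 0 s) (fun i A => H A i)) as (ga & L & Hga).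
    + destruct (HH 0) as (ga & L & _). eauto.
    + auto.
    + exists ga. split; auto. apply (dlim_combine (seq 0 s) ga (fun i A => H A i)); auto.
      intros A B E. apply stage_agree. intros i Hi. apply E, in_seq. lia.
  - intro A. destruct (classic (P (H A))) as [HP|HP].
    + apply (stage_open P (H A) (jump_open e)) in HP as HS. destruct HS as [s Hs].
      exists s. intros n Hn. rewrite (stage_mono P s n); auto. symmetry. now apply tobool_true.
    + exists 0. intros n _. apply bool_ext. rewrite tobool_true. split; [|tauto].
      intro Hs. exfalso. apply HP, (stage_open P (H A) (jump_open e)). eauto.
Qed.

Lemma loc_const_join Z i : loc_const (fun A => join A Z i).
Proof.
  intro A. exists (S i). intros B E. unfold join. destruct (Nat.even i); auto.
  apply E. destruct i; simpl; [lia|]. pose proof (Nat.le_div2 i).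
  pose proof (Nat.div2_decr (S i) i). simpl in *. lia.
Qed.

Lemma pow2_inj b c : 2 ^ b = 2 ^ c -> b = c.
Proof. apply Nat.pow_inj_r. lia. Qed.

Lemma pow5_inj e e' : 3 * 5 ^ e = 3 * 5 ^ e' -> e = e'.
Proof. intro H. apply (Nat.pow_inj_r 5); lia. Qed.

Lemma pow2_not_lim b e : 2 ^ b <> 3 * 5 ^ e.
Proof.
  intro H. assert (O5 : Nat.odd (3 * 5 ^ e) = true).
  { rewrite Nat.odd_mul. clear H. induction e as [|e IH]; [reflexivity|].
    rewrite Nat.pow_succ_r', Nat.odd_mul. exact IH. }
  rewrite <- H in O5. destruct b.
  - simpl in H. pose proof (Nat.pow_nonzero 5 e). lia.
  - rewrite Nat.pow_succ_r', Nat.odd_mul in O5. discriminate.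
Qed.

(** * Notations and the sets [H] *)

Section KleeneO.
Context (Z : Cantor).

(** Keeps successor notations apart from the least notation [1 = 2 ^ 0]. *)
Lemma inO_nonzero b : inO Z b -> b <> 0.
Proof.
  destruct 1 as [|b _|e _]; [lia|apply Nat.pow_nonzero; lia|].
  pose proof (Nat.pow_nonzero 5 e). lia.
Qed.

Lemma inO_lim_inv e : inO Z (3 * 5 ^ e) ->
  forall n, exists m k, phi Z e n m /\ phi Z e (S n) k /\ ltO Z m k.
Proof.
  intro H. remember (3 * 5 ^ e) as a eqn:Ea. destruct H as [|b _|e' H].
  - exfalso. apply (pow2_not_lim 0 e). exact Ea.
  - exfalso. now apply (pow2_not_lim b e).
  - now apply pow5_inj in Ea as ->.
Qed.

Lemma rankO_succ_inv b o : inO Z b -> rankO Z (2 ^ b) o -> exists ob, o = OS ob /\ rankO Z b ob.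
Proof.
  intros Hb H. remember (2 ^ b) as a eqn:Ea. destruct H as [|b' o _ H|e f _ _].
  - exfalso. apply (inO_nonzero b Hb). symmetry. now apply pow2_inj.
  - apply pow2_inj in Ea as ->. eauto.
  - exfalso. now apply (pow2_not_lim b e).
Qed.

Lemma rankO_lim_inv e o : rankO Z (3 * 5 ^ e) o ->
  exists f, o = OL f /\ forall n m, phi Z e n m -> rankO Z m (f n).
Proof.
  intro H. remember (3 * 5 ^ e) as a eqn:Ea. destruct H as [|b o _ _|e' f _ H].
  - exfalso. now apply (pow2_not_lim 0 e).
  - exfalso. now apply (pow2_not_lim b e).
  - apply pow5_inj in Ea as ->. eauto.
Qed.

Lemma rankO_unique a o : rankO Z a o -> forall o', rankO Z a o' -> oeq o o'.
Proof.
  induction 1 as [|b o Hb _ IH|e f He _ IH]; intros o' H'.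
  - remember 1 as a eqn:Ea. destruct H' as [|b o Hb _|e f He _].
    + split; apply ole_Z.
    + exfalso. apply (inO_nonzero b Hb). now apply pow2_inj.
    + exfalso. now apply (pow2_not_lim 0 e).
  - destruct (rankO_succ_inv b o' Hb H') as (ob & -> & Hob).
    destruct (IH ob Hob). split; apply ole_S_iff, olt_S_iff; auto.
  - destruct (rankO_lim_inv e o' H') as (f' & -> & Hf').
    assert (E : forall n, oeq (f n) (f' n)).
    { intro n. destruct (inO_lim_inv e He n) as (m & _ & Hm & _). apply (IH n m Hm), Hf', Hm. }
    split; apply ole_L; intro n.
    + eapply ole_trans; [apply E|apply ole_L_ub].
    + eapply ole_trans; [apply E|apply ole_L_ub].
Qed.

Lemma ltO_cases u a : ltO Z u a ->
  (exists b, a = 2 ^ b /\ inO Z b /\ (u = b \/ ltO Z u b)) \/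
  (exists e n m, a = 3 * 5 ^ e /\ inO Z a /\ phi Z e n m /\ (u = m \/ ltO Z u m)).
Proof.
  induction 1 as [b Hb|e n m He Hm|a b c Hab _ Hbc IH].
  - left. exists b. auto.
  - right. exists e, n, m. auto.
  - destruct IH as [(d & -> & Hd & [->|H])|(e & n & m & -> & He & Hm & [->|H])].
    + left. exists d. auto.
    + left. exists d. split; auto. split; auto. right. now apply ltO_trans with b.
    + right. exists e, n, m. auto.
    + right. exists e, n, m. repeat split; auto. right. now apply ltO_trans with b.
Qed.

Lemma Hrel_succ_inv X b S : inO Z b -> Hrel Z X (2 ^ b) S ->
  exists T, Hrel Z X b T /\ S = jump (tobool T).
Proof.
  intros Hb H. remember (2 ^ b) as a eqn:Ea. destruct H as [|b' T _ H|e Hs _ _].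
  - exfalso. apply (inO_nonzero b Hb). symmetry. now apply pow2_inj.
  - apply pow2_inj in Ea as ->. eauto.
  - exfalso. now apply (pow2_not_lim b e).
Qed.

Lemma Hrel_unique X a S : Hrel Z X a S -> forall S', Hrel Z X a S' -> S = S'.
Proof.
  induction 1 as [|b S Hb _ IH|e Hs He _ IH]; intros S' H'.
  - remember 1 as a eqn:Ea. destruct H' as [|b S Hb _|e Hs He _]; auto.
    + exfalso. apply (inO_nonzero b Hb). now apply pow2_inj.
    + exfalso. now apply (pow2_not_lim 0 e).
  - destruct (Hrel_succ_inv X b S' Hb H') as (T & HT & ->). now rewrite (IH T HT).
  - remember (3 * 5 ^ e) as a eqn:Ea. destruct H' as [|b S Hb _|e' Hs' He' H'].
    + exfalso. now apply (pow2_not_lim 0 e).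
    + exfalso. now apply (pow2_not_lim b e).
    + apply pred_ext. intro n.
      split; intros [L Hn]; split; auto.
      * now rewrite <- (IH _ L _ (H' _ L)).
      * now rewrite (IH _ L _ (H' _ L)).
Qed.

Lemma Hset_eq X a S : Hrel Z X a S -> Hset Z X a = S.
Proof.
  intro H. apply pred_ext. intro i. split.
  - intros (S' & H' & Hi). now rewrite (Hrel_unique X a S H S' H').
  - intro Hi. now exists S.
Qed.

Definition Hdefined a := forall X, Hrel Z X a (Hset Z X a).

Lemma Hdefined_intro a : (forall X, exists S, Hrel Z X a S) -> Hdefined a.
Proof. intros H X. destruct (H X) as [S HS]. now rewrite (Hset_eq X a S HS). Qed.

Definition Hbit a i := fun A => tobool (Hset Z (join A Z) a) i.

Lemma Hset_succ X b : inO Z b -> Hdefined b -> Hset Z X (2 ^ b) = jump (tobool (Hset Z X b)).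
Proof. intros Hb Hd. apply Hset_eq. now apply H_succ. Qed.

Definition tame a o := rankO Z a o /\ Hdefined a /\ forall i, dlim o (Hbit a i).

Lemma Hset_lim X e : inO Z (3 * 5 ^ e) -> (forall u, ltO Z u (3 * 5 ^ e) -> Hdefined u) ->
  Hrel Z X (3 * 5 ^ e) (fun n => ltO Z (fst (unpair n)) (3 * 5 ^ e) /\
    Hset Z X (fst (unpair n)) (snd (unpair n))).
Proof. intros He Hd. apply (H_lim Z X e (fun u => Hset Z X u)); auto. intros u Hu. now apply Hd. Qed.

(** Each bit at a limit is a bit of one earlier set or constantly false, hence of a class strictly
    below, although no single class need serve all bits. *)
Lemma Hbit_lim e o i : inO Z (3 * 5 ^ e) ->
  (forall u, ltO Z u (3 * 5 ^ e) -> exists o', olt o' o /\ tame u o') ->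
  exists o', olt o' o /\ dlim o' (Hbit (3 * 5 ^ e) i).
Proof.
  intros He Hu.
  assert (E : Hbit (3 * 5 ^ e) i = fun A => tobool (fun n => ltO Z (fst (unpair n)) (3 * 5 ^ e) /\
    Hset Z (join A Z) (fst (unpair n)) (snd (unpair n))) i).
  { apply functional_extensionality. intro A. unfold Hbit. f_equal. apply Hset_eq, Hset_lim; auto.
    intros u L. now destruct (Hu u L) as (o' & _ & _ & ? & _). }
  rewrite E. destruct (classic (ltO Z (fst (unpair i)) (3 * 5 ^ e))) as [L|L].
  - destruct (Hu _ L) as (o' & Lo & _ & _ & D). exists o'. split; auto.
    specialize (D (snd (unpair i))).
    replace (fun A => tobool _ i) with (Hbit (fst (unpair i)) (snd (unpair i))); auto.
    apply functional_extensionality. intro A. apply bool_ext. unfold Hbit.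
    rewrite !tobool_true. tauto.
  - destruct (inO_lim_inv e He 0) as (m & _ & Hm & _).
    destruct (Hu m) as (o' & Lo & _); [now apply ltO_lim with 0|].
    exists o'. split; auto. apply dlim_const. intro A. exists 0. intros B _.
    apply bool_ext. rewrite !tobool_true. tauto.
Qed.

Lemma rankO_tame a o : rankO Z a o ->
  tame a o /\ forall u, ltO Z u a -> exists o', olt o' o /\ tame u o'.
Proof.
  induction 1 as [|b o Hb Hr [T IH]|e f He Hr IH].
  - split.
    + split; [apply rk_one|split].
      * apply Hdefined_intro. intro X. eexists. apply H_one.
      * intro i. apply dlim_const. intro A. destruct (loc_const_join Z i A) as [n Hn].
        exists n. intros B E. unfold Hbit. rewrite !(Hset_eq _ _ _ (H_one Z _)).
        apply bool_ext. rewrite !tobool_true. now rewrite (Hn B E).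
    + intros u L. exfalso. apply ltO_cases in L as [(b & E & Hb & _)|(e & n & m & E & _)].
      * apply (inO_nonzero b Hb). symmetry. now apply pow2_inj.
      * now apply (pow2_not_lim 0 e).
  - destruct T as (_ & Hd & D). split.
    + split; [now apply rk_succ|split].
      * apply Hdefined_intro. intro X. eexists. now apply H_succ.
      * intro i. unfold Hbit.
        replace (fun A => tobool (Hset Z (join A Z) (2 ^ b)) i) with
          (fun A => tobool (jump (tobool (Hset Z (join A Z) b))) i).
        { apply dlim_jump. intro j. exists o. split; [apply olt_S, ole_refl|apply D]. }
        apply functional_extensionality. intro A. now rewrite Hset_succ.
    + intros u L. apply ltO_cases in L as [(b' & E & _ & L)|(e & n & m & E & _)].
      * apply pow2_inj in E as <-. destruct L as [->|L].
        { exists o. split; [apply olt_S, ole_refl|]. repeat split; auto. }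
        { destruct (IH u L) as (o' & Lo & T). exists o'. split; auto.
          apply olt_S. now apply olt_ole. }
      * exfalso. now apply (pow2_not_lim b e).
  (* [OL] is a supremum that may be attained; strictness comes from the increase of the fundamental
     sequence. *)
  - assert (Hlt : forall n, olt (f n) (OL f)).
    { intro n. destruct (inO_lim_inv e He n) as (m & k & Hm & Hk & L).
      destruct (proj2 (IH (S n) k Hk) m L) as (o' & Lo & T).
      apply olt_L with (S n). eapply ole_olt_trans; [|exact Lo].
      apply (rankO_unique m (f n)); [now apply Hr|apply T]. }
    assert (Hu : forall u, ltO Z u (3 * 5 ^ e) -> exists o', olt o' (OL f) /\ tame u o').
    { intros u L. apply ltO_cases in L as [(b & E & _)|(e' & n & m & E & _ & Hm & L)].
      - exfalso. now apply (pow2_not_lim b e).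
      - apply pow5_inj in E as <-. destruct L as [->|L].
        + exists (f n). split; auto. now apply (IH n m).
        + destruct (proj2 (IH n m Hm) u L) as (o' & Lo & T). exists o'. split; auto.
          eapply olt_trans; eauto. }
    split; auto. split; [now apply rk_lim|split].
    + apply Hdefined_intro. intro X. eexists. apply Hset_lim; auto.
      intros u L. now destruct (Hu u L) as (o' & _ & _ & ? & _).
    + intro i. destruct (Hbit_lim e (OL f) i He Hu) as (o' & Lo & D).
      eapply dlim_mono; [exact D|now apply olt_ole].
Qed.

(* Past [omega] the index of [H] lags one behind the rank: the bits of [H_b] at a limit [b]
   already have rank below that of [b]. *)
Lemma Hbit_infinite b o : rankO Z b o -> ~ (exists n, oeq o (ofin n)) ->
  forall i, dlim o (Hbit (2 ^ b) i).
Proof.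
  intros H N i. pose proof (rankO_tame b o H) as [(_ & Hd & _) Hu].
  assert (Hb : inO Z b) by (destruct H; [apply O_one|now apply O_succ|auto]).
  assert (E : Hbit (2 ^ b) i = fun A => tobool (jump (fun j => Hbit b j A)) i).
  { apply functional_extensionality. intro A. unfold Hbit at 1. now rewrite Hset_succ. }
  rewrite E. clear E. revert i N Hd Hu Hb.
  induction H as [|b o Hb Hr IH|e f He Hr _]; intros i N Hd Hu Hb'.
  - exfalso. apply N. exists 0. split; apply ole_Z.
  - apply dlim_jump. intro j. exists o. split; [apply olt_S, ole_refl|].
    pose proof (rankO_tame b o Hr) as [(_ & Hdb & _) Hub].
    replace (fun A => Hbit (2 ^ b) j A) with (fun A => tobool (jump (fun j => Hbit b j A)) j).
    + apply IH; auto. intros [n [H1 H2]]. apply N. exists (S n). simpl.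
      split; apply ole_S_iff, olt_S_iff; auto.
    + apply functional_extensionality. intro A. unfold Hbit. now rewrite Hset_succ.
  - apply dlim_jump. intro j. now apply Hbit_lim.
Qed.

Lemma rankO_succ_shape a al o : rankO Z a o -> oeq o (OS al) ->
  exists b ob, a = 2 ^ b /\ inO Z b /\ rankO Z b ob /\ oeq ob al.
Proof.
  intros H E. destruct H as [|b o Hb H|e f He Hr].
  - destruct E as [_ E]. apply ole_S_iff in E. now apply not_olt_Z in E.
  - exists b, o. pose proof (oeq_S_inv _ _ E). auto.
  (* A limit notation cannot have successor rank: [al] would lie below some [f n], while [f n] is
     below [f (S n)], which is at most [OS al]. *)
  - exfalso. destruct E as [E1 E2]. apply ole_S_iff, olt_L_iff in E2 as [n Hn].
    destruct (inO_lim_inv e He n) as (m & k & Hm & Hk & L).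
    destruct (proj2 (rankO_tame k _ (Hr _ _ Hk)) m L) as (o' & Lo & T).
    assert (Lf : olt (f n) (f (S n))).
    { eapply ole_olt_trans; [|exact Lo]. apply (rankO_unique m (f n)); [now apply Hr|apply T]. }
    assert (U : ole (f (S n)) (OS al)) by (eapply ole_trans; [apply ole_L_ub|exact E1]).
    apply (olt_irrefl al). eapply olt_ole_trans; [exact Hn|].
    apply olt_S_iff. eapply olt_ole_trans; eauto.
Qed.

Lemma jumpn_dlim n : forall i, dlim (ofin n) (fun A => tobool (jumpn (join A Z) n) i).
Proof.
  induction n as [|n IH]; intro i; simpl.
  - apply dlim_const. intro A. destruct (loc_const_join Z i A) as [m Hm]. exists m.
    intros B E. apply bool_ext. rewrite !tobool_true. simpl. now rewrite (Hm B E).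
  - apply dlim_jump. intro j. exists (ofin n). split; auto. apply olt_S, ole_refl.
Qed.

(** For finite rank the last of the iterated jumps is split off. For infinite rank, with
    [a = 2 ^ b], the set is the jump of [H] at [2 ^ b], whose bits lie in the class of the rank of
    [b], equal to [al], by the lag in [Hbit_infinite]. *)
Lemma jumpset_jump a al o : rankO Z a o -> oeq o (OS al) ->
  exists H : Cantor -> Cantor, (forall i, dlim al (fun A => H A i)) /\
    forall A, jumpset Z a A = jump (H A).
Proof.
  intros Hr E.
  destruct (rankO_succ_shape a al o Hr E) as (b & ob & -> & Hb & Hrb & Eb).
  destruct (classic (exists n, oeq o (ofin n))) as [[n Hn]|N].
  - destruct n as [|n].
    { exfalso. pose proof (oeq_trans _ _ _ (oeq_sym _ _ E) Hn) as [C _].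
      apply ole_S_iff in C. now apply not_olt_Z in C. }
    exists (fun A => tobool (jumpn (join A Z) n)). split.
    + intro i. apply (dlim_mono (ofin n)); [apply jumpn_dlim|].
      apply (oeq_S_inv (ofin n) al). exact (oeq_trans _ _ _ (oeq_sym _ _ Hn) E).
    + intro A. change (jump _) with (jumpn (join A Z) (S n)). apply pred_ext. intro i.
      unfold jumpset. split.
      * intros [(m & o' & Hr' & E' & Hi)|[C _]]; [|exfalso; eauto].
        replace (S n) with m; auto. apply ofin_inj.
        apply (oeq_trans _ o'); [now apply oeq_sym|].
        apply (oeq_trans _ o); auto. now apply (rankO_unique (2 ^ b) _).
      * intro Hi. left. exists (S n), o. auto.
  - exists (fun A => tobool (Hset Z (join A Z) (2 ^ b))). split.
    + intro i. apply (dlim_mono ob); [|apply Eb]. apply Hbit_infinite; auto.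
      intros [n [H1 H2]]. apply N. exists (S n). apply (oeq_trans _ (OS al)); auto.
      destruct Eb as [B1 B2]. simpl.
      split; apply ole_S_iff, olt_S_iff; eapply ole_trans; eauto.
    + intro A. pose proof (proj1 (rankO_tame _ _ Hr)) as (_ & Hd & _).
      rewrite <- (Hset_succ (join A Z) (2 ^ b)); auto; [|now apply O_succ].
      apply pred_ext. intro i. unfold jumpset. split; [|auto].
      * intros [(m & o' & Hr' & E' & Hi)|[_ Hi]]; auto. exfalso. apply N. exists m.
        apply (oeq_trans _ o'); auto. now apply (rankO_unique (2 ^ b) _).
      * intro Hi. right. split; auto. intros (m & o' & Hr' & E'). apply N. exists m.
        apply (oeq_trans _ o'); auto. now apply (rankO_unique (2 ^ b) _).
Qed.

End KleeneO.

(** * The jump functions and the dichotomy *)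

Open Scope R_scope.

Section SetReal.
Context (P : nat -> Prop).

Definition digit i : R := if excluded_middle_informative (P i) then / 2 ^ (S i) else 0.

Lemma digit_bounds i : 0 <= digit i <= / 2 ^ (S i).
Proof.
  assert (0 < / 2 ^ (S i)) by (apply Rinv_0_lt_compat, pow_lt; lra).
  unfold digit. destruct excluded_middle_informative; lra.
Qed.

Lemma digits_growing : Un_growing (sum_f_R0 digit).
Proof. intro n. simpl. pose proof (digit_bounds (S n)). simpl in *. lra. Qed.

Lemma digits_le n : sum_f_R0 digit n <= 1 - / 2 ^ (S n).
Proof.
  induction n as [|n IH].
  - pose proof (digit_bounds 0). simpl in *. lra.
  - cbn [sum_f_R0]. pose proof (digit_bounds (S n)) as [_ B].
    assert (E : / 2 ^ S n = / 2 ^ S (S n) + / 2 ^ S (S n)).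
    { change (2 ^ S (S n)) with (2 * 2 ^ S n). rewrite Rinv_mult. field.
      apply pow_nonzero. lra. }
    lra.
Qed.

Lemma setreal_cv : Un_cv (sum_f_R0 digit) (setreal P).
Proof.
  destruct (growing_cv _ digits_growing) as [l Hl].
  - exists 1. intros x [n ->]. pose proof (digits_le n).
    assert (0 < / 2 ^ (S n)) by (apply Rinv_0_lt_compat, pow_lt; lra). lra.
  - apply (epsilon_spec (inhabits 0) (fun y => infinite_sum digit y)). now exists l.
Qed.

Lemma setreal_gt p : p < setreal P <-> exists n, p < sum_f_R0 digit n.
Proof.
  split.
  - intro H. destruct (setreal_cv (setreal P - p)) as [N HN]; [lra|].
    exists N. specialize (HN N (Nat.le_refl N)). unfold Rdist in HN.
    apply Rabs_def2 in HN. lra.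
  - intros [n Hn]. pose proof (growing_ineq _ _ digits_growing setreal_cv n). lra.
Qed.

End SetReal.

Lemma sum_digit_mono P Q n : (forall i, (i <= n)%nat -> P i -> Q i) ->
  sum_f_R0 (digit P) n <= sum_f_R0 (digit Q) n.
Proof.
  intro H. apply sum_Rle. intros i Hi. pose proof (digit_bounds Q i) as B. unfold digit in *.
  do 2 destruct excluded_middle_informative; try lra. exfalso. auto.
Qed.

Definition above p : Cantor -> Prop := fun X => p < setreal (jump X).

(** A partial sum beyond [p] rests on finitely many members of the jump. They persist for oracles
    agreeing on a common use, and new members only increase the sum. *)
Lemma above_open p : open_class (above p).
Proof.
  intros X H. apply setreal_gt in H as [n Hn].
  assert (HN : exists N, forall m, (m < S n)%nat ->
    jump X m -> forall X', agree X X' N -> jump X' m).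
  { apply (bounded_choice (fun m N => jump X m -> forall X', agree X X' N -> jump X' m)).
    - intros m N N' HN L J X' E. apply HN; auto. now apply (agree_le _ _ N').
    - intros m _. destruct (classic (jump X m)) as [J|J]; [|exists 0%nat; tauto].
      destruct (jump_open m X J) as [N HN]. exists N. auto. }
  destruct HN as [N HN]. exists N. intros X' E. apply setreal_gt. exists n.
  eapply Rlt_le_trans; [exact Hn|]. apply sum_digit_mono.
  intros i Hi J. apply (HN i); auto. lia.
Qed.

Lemma borel_above al (H : Cantor -> Cantor) p :
  (forall i, dlim al (fun A => H A i)) -> borel_set (fun A => above p (H A)).
Proof.
  intro HH. apply (bs_ext (fun A => exists s, stage (above p) s (H A) = true)).
  - intro A. symmetry. apply stage_open, above_open.
  - apply bs_union. intro s. apply (borel_dlim al). now apply dlim_stage.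
Qed.

Lemma borel_ge f c : borel_fun f -> borel_set (fun A => c <= f A).
Proof.
  intro Hf. apply (bs_ext (fun A => ~ f A < c)); [intro; split; lra|].
  apply bs_compl, (Hf (fun y => y < c)). intros y Hy.
  assert (Hd : 0 < c - y) by lra. exists (mkposreal _ Hd). intros z Hz.
  unfold disc in Hz. simpl in Hz. apply Rabs_def2 in Hz. lra.
Qed.

Lemma borel_le f c : borel_fun f -> borel_set (fun A => f A <= c).
Proof.
  intro Hf. apply (bs_ext (fun A => ~ c < f A)); [intro; split; lra|].
  apply bs_compl, (Hf (fun y => c < y)). intros y Hy.
  assert (Hd : 0 < y - c) by lra. exists (mkposreal _ Hd). intros z Hz.
  unfold disc in Hz. simpl in Hz. apply Rabs_def2 in Hz. lra.
Qed.

(** A correct [true] excludes [p < h A] and a correct [false] excludes its negation; [eps] has to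
    absorb only the case [h A = p]. *)
Lemma mred_of_reductions (h f : Cantor -> R) :
  (forall p : R, exists (q delta : Q) k, (0 < delta)%Q /\ cont_cantor k /\ forall A,
     (p < h A -> Q2R q + Q2R delta <= f (k A)) /\
     (~ p < h A -> f (k A) <= Q2R q - Q2R delta)) -> mred h f.
Proof.
  intros H p eps He. destruct (H (Q2R p)) as (q & delta & k & Hd & Hk & HA).
  exists q, delta, k. repeat split; auto. intros A b Hb.
  apply Qreals.Qlt_Rlt in He. replace (Q2R 0) with 0 in He by (unfold Q2R; simpl; lra).
  destruct (HA A) as [H1 H2].
  destruct Hb as [[-> Hb]|[-> Hb]]; [left|right]; split; auto.
  - destruct (Rlt_dec (Q2R p) (h A)) as [L|L]; [specialize (H1 L)|]; lra.
  - destruct (Rlt_dec (Q2R p) (h A)) as [L|L]; [|specialize (H2 L)]; lra.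
Qed.

Lemma mred_opp_of_reductions (h f : Cantor -> R) :
  (forall p : R, exists (q delta : Q) k, (0 < delta)%Q /\ cont_cantor k /\ forall A,
     (p < h A -> f (k A) <= Q2R q - Q2R delta) /\
     (~ p < h A -> Q2R q + Q2R delta <= f (k A))) -> mred (fun A => - h A) f.
Proof.
  intros H p eps He. destruct (H (- Q2R p)) as (q & delta & k & Hd & Hk & HA).
  exists q, delta, k. repeat split; auto. intros A b Hb.
  apply Qreals.Qlt_Rlt in He. replace (Q2R 0) with 0 in He by (unfold Q2R; simpl; lra).
  destruct (HA A) as [H1 H2].
  destruct Hb as [[-> Hb]|[-> Hb]]; [left|right]; split; auto.
  - destruct (Rlt_dec (- Q2R p) (h A)) as [L|L]; [|specialize (H2 L)]; lra.
  - destruct (Rlt_dec (- Q2R p) (h A)) as [L|L]; [specialize (H1 L)|]; lra.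
Qed.

Section Separation.
Context (al : Ord) (f : Cantor -> R) (H : Cantor -> Cantor).
Context (Hf : borel_fun f) (HH : forall i, dlim al (fun A => H A i)).

Let h A := setreal (jump (H A)).

Lemma separator p k : cont_cantor k ->
  exists w : nat -> Cantor -> bool, (forall s, dlim al (w s)) /\
    forall B, p < h (k B) <-> exists s, w s B = true.
Proof.
  intro Hk. exists (fun s B => stage (above p) s (H (k B))). split.
  - intro s. apply (dlim_preimage al (fun A => stage (above p) s (H A)) k Hk).
    now apply dlim_stage.
  - intro B. apply (stage_open (above p)), above_open.
Qed.

Lemma separate_low : ~ mred h f -> forall q delta : Q, (0 < delta)%Q ->
  exists w : nat -> Cantor -> bool, (forall s, dlim al (w s)) /\ forall B,
    (f B <= Q2R q - Q2R delta -> exists s, w s B = true) /\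
    (forall s, w s B = true -> f B < Q2R q + Q2R delta).
Proof.
  intros N q delta Hd. apply NNPP. intro C. apply N, mred_of_reductions. intro p.
  destruct (wadge_dichotomy (fun A => p < h A) (fun B => Q2R q + Q2R delta <= f B)
    (fun B => f B <= Q2R q - Q2R delta)) as [(k & Hk & HA)|(k & Hk & HB)].
  - now apply (borel_above al).
  - now apply borel_ge.
  - now apply borel_le.
  - now exists q, delta, k.
  - exfalso. apply C. destruct (separator p k Hk) as (w & Hw & Sp). exists w. split; auto.
    intro B. destruct (HB B) as [B1 B0]. split.
    + intro L. now apply Sp, B0.
    + intros s Hs. apply Rnot_le_lt. intro L. apply (B1 L), Sp. eauto.
Qed.

Lemma separate_high : ~ mred (fun A => - h A) f -> forall q delta : Q, (0 < delta)%Q ->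
  exists w : nat -> Cantor -> bool, (forall s, dlim al (w s)) /\ forall B,
    (Q2R q + Q2R delta <= f B -> exists s, w s B = true) /\
    (forall s, w s B = true -> Q2R q - Q2R delta < f B).
Proof.
  intros N q delta Hd. apply NNPP. intro C. apply N, mred_opp_of_reductions. intro p.
  destruct (wadge_dichotomy (fun A => p < h A) (fun B => f B <= Q2R q - Q2R delta)
    (fun B => Q2R q + Q2R delta <= f B)) as [(k & Hk & HA)|(k & Hk & HB)].
  - now apply (borel_above al).
  - now apply borel_le.
  - now apply borel_ge.
  - now exists q, delta, k.
  - exfalso. apply C. destruct (separator p k Hk) as (w & Hw & Sp). exists w. split; auto.
    intro B. destruct (HB B) as [B1 B0]. split.
    + intro L. now apply Sp, B0.
    + intros s Hs. apply Rnot_le_lt. intro L. apply (B1 L), Sp. eauto.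
Qed.

(* At precision [3 d] a value [z d] is certified once [f < (z + 2) d] and [f > (z - 3) d]
   have both been witnessed; [z = a - b] and the two witnesses are coded by one number. *)
Lemma baire_of_not_mred : ~ mred h f -> ~ mred (fun A => - h A) f -> baire al f.
Proof.
  intros N1 N2. apply baire_of_approximations. intro k.
  set (d := (1 # Pos.of_nat (3 * S k))%Q).
  assert (Hd : (0 < d)%Q) by reflexivity.
  assert (Ed : 3 * Q2R d = / INR (S k)).
  { unfold d, Q2R. cbn [Qnum Qden].
    replace (IZR (Zpos (Pos.of_nat (3 * S k)))) with (INR (3 * S k)).
    - rewrite mult_INR. change (INR 3) with (2 + 1). field. apply not_0_INR. lia.
    - rewrite INR_IZR_INZ. f_equal. rewrite <- positive_nat_Z, Nat2Pos.id by lia. reflexivity. }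
  assert (Hd' : 0 < Q2R d).
  { assert (0 < / INR (S k)) by (apply Rinv_0_lt_compat, lt_0_INR; lia). lra. }
  destruct (choice _ (fun q => separate_low N1 q d Hd)) as [u Hu].
  destruct (choice _ (fun q => separate_high N2 q d Hd)) as [v Hv].
  set (val := fun a b => (inject_Z (Z.of_nat a - Z.of_nat b) * d)%Q).
  set (dec := fun i => let (ab, st) := Cantor.of_nat i in
    (Cantor.of_nat ab, Cantor.of_nat st)).
  exists (fun i B => let '((a, b), (s, t)) := dec i in
    u (val a b + d)%Q s B && v (val a b - 2 * d)%Q t B)%bool.
  exists (fun i => let '((a, b), _) := dec i in Q2R (val a b)).
  split; [|split].
  - intro i. destruct (dec i) as [[a b] [s t]].
    apply (dlim_combine [u (val a b + d)%Q s; v (val a b - 2 * d)%Q t] al (fun F => F)).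
    + intros F [<-|[<-|[]]]; [apply Hu|apply Hv].
    + intros A B E. rewrite (E (u (val a b + d)%Q s)), (E (v (val a b - 2 * d)%Q t)); simpl; auto.
  (* [up] rounds upwards, so [f B <= z d <= f B + d]. With the centres [z d + d] and [z d - 2 d]
     these two inequalities are exactly the premises of [Hu] and [Hv]. *)
  - intro B. set (z := up (f B / Q2R d)).
    assert (Hz : f B <= IZR z * Q2R d <= f B + Q2R d).
    { destruct (archimed (f B / Q2R d)) as [H1 H2]. fold z in H1, H2.
      assert (E : f B = f B / Q2R d * Q2R d) by (field; lra).
      split.
      - rewrite E. apply Rmult_le_compat_r; lra.
      - rewrite E at 1. replace (f B / Q2R d * Q2R d + Q2R d) with ((f B / Q2R d + 1) * Q2R d) by ring.
        apply Rmult_le_compat_r; lra. }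
    assert (Ez : exists a b, (Z.of_nat a - Z.of_nat b)%Z = z).
    { exists (Z.to_nat z), (Z.to_nat (- z)). lia. }
    destruct Ez as (a & b & Ez).
    assert (Eq : Q2R (val a b) = IZR z * Q2R d).
    { unfold val. rewrite Qreals.Q2R_mult, Ez. f_equal. unfold Q2R, inject_Z. simpl. field. }
    destruct (proj1 (proj2 (Hu (val a b + d)%Q) B)) as [s Hs].
    { rewrite Qreals.Q2R_plus. lra. }
    destruct (proj1 (proj2 (Hv (val a b - 2 * d)%Q) B)) as [t Ht].
    { rewrite Qreals.Q2R_minus, Qreals.Q2R_mult. replace (Q2R 2) with 2 by (unfold Q2R; simpl; lra). lra. }
    exists (Cantor.to_nat (Cantor.to_nat (a, b), Cantor.to_nat (s, t))).
    unfold dec. rewrite !Cantor.cancel_of_to. now rewrite Hs, Ht.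
  - intros i B. destruct (dec i) as [[a b] [s t]]. intro E.
    apply andb_prop in E as [E1 E2].
    apply (proj2 (Hu (val a b + d)%Q)) in E1. apply (proj2 (Hv (val a b - 2 * d)%Q)) in E2.
    rewrite Qreals.Q2R_plus in E1.
    rewrite Qreals.Q2R_minus, Qreals.Q2R_mult in E2.
    replace (Q2R 2) with 2 in E2 by (unfold Q2R; simpl; lra).
    rewrite <- Ed. apply Rabs_def1; lra.
Qed.

End Separation.

Theorem theorem1p1 :
  forall (al : Ord) (f : Cantor -> R),
    borel_fun f -> ~ baire al f ->
    forall (Z : Cantor) (a : nat),
      inO Z a ->
      (exists o, rankO Z a o /\ oeq o (OS al)) ->
      mred (jfun Z a) f \/ mred (fun A => - jfun Z a A) f.
Proof.
  intros al f Hf Hb Z a _ (o & Hr & E).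
  destruct (jumpset_jump Z a al o Hr E) as (H & HH & HJ).
  assert (Ej : jfun Z a = fun A => setreal (jump (H A))).
  { apply functional_extensionality. intro A. unfold jfun. now rewrite HJ. }
  rewrite Ej. apply NNPP. intro C. apply Hb.
  apply (baire_of_not_mred al f H Hf HH); intro M; apply C; auto.
Qed.
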